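(* Let $\mathbf A\in\mathbb R^{n\times d}$ (rank $d$) have a nondegenerate optimal design, let $\varepsilon\in(0,1)$, and let the algorithm FacialNewton (defined in the context) be started at any $\mathbf p^{(0)}\in\operatorname{relint}\Delta_{S^\star}$ with $h(\mathbf p^{(0)})-f^\star\le c_0$. Set $$\tau:=\min\Big\{\tfrac14,\ \frac{\varepsilon d}{\sqrt{\tfrac43L_{\mathrm{loc}}\kappa_{\mathrm{loc}}}}\Big\}=\min\Big\{\tfrac14,\ \frac{\varepsilon d}{4\sqrt{3\widehat L_\star\kappa}}\Big\},\qquad \Theta_{\mathrm N}:=\frac{4\sqrt{3\widehat L_\star\kappa}}{d},\qquad \lceil x\rceil^+:=\max\{\lceil x\rceil,0\}.$$ Then: (i) FacialNewton returns a point $\mathbf p\in\operatorname{relint}\Delta_{S^\star}$ with $\max_iv_i(\mathbf p)\le(1+\varepsilon)d$ after at most $$N\le 3+\Big\lceil\log_2\log_2\tfrac1{2\tau}\Big\rceil^{+}+1=O(1)+O\Big(\log\log\frac{\Theta_{\mathrm N}}{\varepsilon}\Big)$$ iterations (at most $3$ damped steps, at most $\lceil\log_2\log_2\frac1{2\tau}\rceil^+$ full steps, and one terminal test). (ii) Each iteration uses at most $m+1\le\binom{d+1}2+1$ leverage-score queries, all at designs in $\Delta_n$; hence the algorithm uses $O\big(d^2\log\log(\Theta_{\mathrm N}/\varepsilon)\big)$ queries in total. (iii) All iterates remain in $\mathcal C_0\subseteq\operatorname{relint}\Delta_{S^\star}$, and no oracle other than leverage scores is used.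
   Context: Setting. $\mathbf A\in\mathbb R^{n\times d}$ has rows $\mathbf a_1,\dots,\mathbf a_n$ and rank $d$. For $\mathbf p\in\mathbb R^n$, $\mathbf M(\mathbf p)=\sum_ip_i\mathbf a_i\mathbf a_i^\top$; when $\mathbf M(\mathbf p)\succ0$, $v_i(\mathbf p)=\mathbf a_i^\top\mathbf M(\mathbf p)^{-1}\mathbf a_i$ and $f(\mathbf p)=-\log\det\mathbf M(\mathbf p)$. $\Delta_n=\{\mathbf p\ge0:\sum p_i=1\}$ (designs), $\Delta_S=\{\mathbf p\in\Delta_n:\operatorname{supp}\mathbf p\subseteq S\}$. A leverage-score query at $\mathbf w$ with $\mathbf M(\mathbf w)\succ0$ returns $(v_i(\mathbf w))_{i\in[n]}$. Nondegeneracy. An optimal design $\mathbf p^\star$ minimizes $f$ over $\Delta_n$, $f^\star=f(\mathbf p^\star)$, $S^\star=\{i:v_i(\mathbf p^\star)=d\}$, $m=|S^\star|$. It is nondegenerate if (i) $\operatorname{supp}\mathbf p^\star=S^\star$ and $\gamma_{\mathrm{sc}}:=\min_{i\notin S^\star}(d-v_i(\mathbf p^\star))>0$ (minimum over the empty set is $+\infty$); (ii) $\{\mathbf a_i\mathbf a_i^\top\}_{i\in S^\star}$ are linearly independent (so $m\le\binom{d+1}2$). $p^\star_{\min}=\min_{i\in S^\star}p^\star_i$. Facial quantities. $V=\{\mathbf p\in\mathbb R^n:\operatorname{supp}\mathbf p\subseteq S^\star,\sum_ip_i=1\}$, $T^\star=\{\boldsymbol\delta:\operatorname{supp}\boldsymbol\delta\subseteq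 S^\star,\sum_i\delta_i=0\}$, $D=\{\mathbf p\in V:\mathbf M(\mathbf p)\succ0\}$, $h=f|_D$, $\widehat{\mathbf H}(\mathbf p)=\big((\mathbf a_i^\top\mathbf M(\mathbf p)^{-1}\mathbf a_j)^2\big)_{i,j\in S^\star}$. $\mu_\star=\lambda_{\min}(\widehat{\mathbf H}(\mathbf p^\star)|_{T^\star})$ (presupposing $T^\star\neq\{0\}$), $\widehat L_\star=\lambda_{\max}(\widehat{\mathbf H}(\mathbf p^\star))$, $\kappa=\widehat L_\star/\mu_\star$, $L_{\mathrm{loc}}=4\widehat L_\star$, $\kappa_{\mathrm{loc}}=9\kappa$. $\zeta(t)=t-\log(1+t)$, $\bar r=\min\{\tfrac12,\gamma_{\mathrm{sc}}/(2d),p^\star_{\min}\sqrt{\mu_\star}/2\}$, $c_0=\zeta(\bar r)$, $\mathcal C_0=\{\mathbf p\in D:h(\mathbf p)\le f^\star+c_0\}$. Algorithm FacialNewton. Repeat, from the current $\mathbf p$: (1) query $\mathbf v=(v_i(\mathbf p))_{i\in[n]}$; if $\max_iv_i-d\le\varepsilon d$, return $\mathbf p$. (2) Query the $m$ designs $\tfrac12(\mathbf p+\mathbf e_j)$, $j\in S^\star$, and compute $\widehat{\mathbf H}=\widehat{\mathbf H}(\mathbf p)$ by the identity $(\mathbf a_i^\top\mathbf M(\mathbf p)^{-1}\mathbf a_j)^2=(v_i(\mathbf p)-v_i(\mathbf p+\mathbf e_j))(1+v_j(\mathbf p))$, where $v_i(\mathbf p+\mathbf e_j)=\tfrac12v_i(\tfrac12(\mathbf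 p+\mathbf e_j))$. (3) Solve for $(\mathbf n,\nu)\in\mathbb R^{S^\star}\times\mathbb R$ the system $\widehat{\mathbf H}\mathbf n+\nu\mathbf 1=(v_i)_{i\in S^\star}$, $\mathbf 1^\top\mathbf n=0$, and put $\lambda=\big(\sum_{i\in S^\star}v_in_i\big)^{1/2}$. (4) If $\lambda>\tfrac14$ set $\mathbf p\leftarrow\mathbf p+\mathbf n/(1+\lambda)$ (damped step), otherwise $\mathbf p\leftarrow\mathbf p+\mathbf n$ (full step), with $\mathbf n$ extended by $0$ outside $S^\star$. Inside $O(\cdot)$, absolute constants are hidden and $\log\log X$ is read as $\max\{1,\log\log X\}$. *)

(* Defs.v *)
From HB Require Import structures.
From mathcomp Require Import all_boot all_order all_algebra.
From mathcomp Require Import all_classical all_reals all_analysis.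

Set Implicit Arguments.
Unset Strict Implicit.
Unset Printing Implicit Defensive.

Import Order.TTheory GRing.Theory Num.Theory.
Import numFieldNormedType.Exports.

Local Open Scope classical_set_scope.
Local Open Scope ring_scope.

(** * Oracle programs *)

(* A program that reaches its data only by asking queries in [Q] answered in
   [B]; everything between two queries is exact computation.  Since the matrix A
   is not an argument of the algorithm below, the answers are all it learns
   about A. *)
Inductive prog (Q B X : Type) : Type :=
| Ret of X
| Ask of Q & (B -> prog Q B X).

Arguments Ret {Q B X} _.
Arguments Ask {Q B X} _ _.

Fixpoint ask_seq (Q B X : Type) (qs : seq Q) (k : seq B -> prog Q B X) :
    prog Q B X :=
  if qs is q :: qs' then Ask q (fun b => ask_seq qs' (fun bs => k (b :: bs)))
  else k [::].

(* The list of queries asked, and the result. *)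
Fixpoint exec (Q B X : Type) (o : Q -> B) (c : prog Q B X) : seq Q * X :=
  match c with
  | Ret x => ([::], x)
  | Ask q k => let r := exec o (k (o q)) in (q :: r.1, r.2)
  end.

(** * Convexity and spectra *)

Definition affine_hull (R : realType) (n : nat) (E : set 'cV[R]_n) :
    set 'cV[R]_n :=
  [set y | exists (k : nat) (c : 'I_k -> R) (x : 'I_k -> 'cV[R]_n),
     [/\ forall j, E (x j), \sum_j c j = 1 & y = \sum_j c j *: x j]].

Definition relint (R : realType) (n : nat) (E : set 'cV[R]_n) : set 'cV[R]_n :=
  [set x | E x /\ within (affine_hull E) (nbhs x) E].

Definition posdef (R : realType) (d : nat) (M : 'M[R]_d) : Prop :=
  M^T = M /\ forall x : 'cV[R]_d, x != 0 -> 0 < (x^T *m M *m x) 0 0.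

(* The set of eigenvalues of a symmetric matrix of positive size is finite and
   nonempty, so that the supremum is attained; likewise for [lambda_min_on]. *)
Definition lambda_max (R : realType) (m : nat) (H : 'M[R]_m) : R :=
  sup [set a : R | eigenvalue H a].

(* Eigenvalues of the restriction to the subspace [T] of the quadratic form of
   [H], that is, of the compression of [H] to [T]: [T] need not be
   [H]-invariant, and the eigenvector equation H x = a x is tested against [T]
   only. *)
Definition eigenvalue_on (R : realType) (m : nat) (T : set 'cV[R]_m)
    (H : 'M[R]_m) (a : R) : Prop :=
  exists x : 'cV[R]_m, [/\ T x, x != 0 &
    forall y, T y -> (y^T *m (H *m x)) 0 0 = a * (y^T *m x) 0 0].

Definition lambda_min_on (R : realType) (m : nat) (T : set 'cV[R]_m)
    (H : 'M[R]_m) : R :=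
  inf [set a : R | eigenvalue_on T H a].

(** * Designs *)

(* a_i is the column vector [(row i A)^T]. *)
Definition info (R : realType) (n d : nat) (A : 'M[R]_(n, d)) (p : 'cV[R]_n) :
    'M[R]_d :=
  \sum_i p i 0 *: ((row i A)^T *m row i A).

Definition leverage (R : realType) (n d : nat) (A : 'M[R]_(n, d))
    (p : 'cV[R]_n) : 'cV[R]_n :=
  \col_i (row i A *m invmx (info A p) *m (row i A)^T) 0 0.

(* Meaningful only when [info A p] is positive definite. *)
Definition fobj (R : realType) (n d : nat) (A : 'M[R]_(n, d)) (p : 'cV[R]_n) :
    R :=
  - ln (\det (info A p)).

(* The base value 0 is harmless: leverage scores are nonnegative. *)
Definition vmax (R : realType) (n : nat) (v : 'cV[R]_n) : R :=
  \big[Num.max/0]_i v i 0.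

Definition supp (R : realType) (n : nat) (p : 'cV[R]_n) : {set 'I_n} :=
  [set i | p i 0 != 0]%SET.

Definition simplex (R : realType) (n : nat) : set 'cV[R]_n :=
  [set p | (forall i, 0 <= p i 0) /\ \sum_i p i 0 = 1].

Arguments simplex : clear implicits.

Definition face (R : realType) (n : nat) (S : {set 'I_n}) : set 'cV[R]_n :=
  [set p | simplex R n p /\ supp p \subset S].

Arguments face : clear implicits.
Arguments face R {n} S.

(* f is +oo outside the positive definite region, hence the restriction. *)
Definition optimal_design (R : realType) (n d : nat) (A : 'M[R]_(n, d))
    (p : 'cV[R]_n) : Prop :=
  [/\ simplex R n p, posdef (info A p) &
      forall q, simplex R n q -> posdef (info A q) -> fobj A p <= fobj A q].

(** * Nondegeneracy; below [p] is the optimal design *)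

Definition contact (R : realType) (n d : nat) (A : 'M[R]_(n, d))
    (p : 'cV[R]_n) : {set 'I_n} :=
  [set i | leverage A p i 0 == d%:R]%SET.

Definition gamma_sc (R : realType) (n d : nat) (A : 'M[R]_(n, d))
    (p : 'cV[R]_n) : \bar R :=
  \big[Order.min/+oo%E]_(i | i \notin contact A p)
    (d%:R - leverage A p i 0)%:E.

Definition nondegenerate_design (R : realType) (n d : nat) (A : 'M[R]_(n, d))
    (p : 'cV[R]_n) : Prop :=
  [/\ optimal_design A p,
      supp p = contact A p,
      (0 < gamma_sc A p)%E &
      free [seq (row i A)^T *m row i A | i <- enum (contact A p)]].

(** * Facial quantities *)

(* R^S is 'cV_#|S|, its k-th coordinate being the one of index [enum_val k]. *)
Definition restrict_to (R : realType) (n : nat) (S : {set 'I_n}) (v : 'cV[R]_n) :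
    'cV[R]_#|S| :=
  \col_k v (enum_val k) 0.

Definition extend (R : realType) (n : nat) (S : {set 'I_n})
    (x : 'cV[R]_#|S|) : 'cV[R]_n :=
  \col_i \sum_(k < #|S| | enum_val k == i) x k 0.

Definition tangent (R : realType) (m : nat) : set 'cV[R]_m :=
  [set x | \sum_k x k 0 = 0].

Arguments tangent : clear implicits.

Definition face_domain (R : realType) (n d : nat) (A : 'M[R]_(n, d))
    (S : {set 'I_n}) : set 'cV[R]_n :=
  [set p | [/\ supp p \subset S, \sum_i p i 0 = 1 & posdef (info A p)]].

Definition Hhat (R : realType) (n d : nat) (A : 'M[R]_(n, d)) (S : {set 'I_n})
    (p : 'cV[R]_n) : 'M[R]_#|S| :=
  \matrix_(i, j)
    (row (enum_val i) A *m invmx (info A p) *m (row (enum_val j) A)^T) 0 0 ^+ 2.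

Definition mu_star (R : realType) (n d : nat) (A : 'M[R]_(n, d))
    (p : 'cV[R]_n) : R :=
  lambda_min_on (tangent R #|contact A p|) (Hhat A (contact A p) p).

Definition L_star (R : realType) (n d : nat) (A : 'M[R]_(n, d))
    (p : 'cV[R]_n) : R :=
  lambda_max (Hhat A (contact A p) p).

Definition kappa (R : realType) (n d : nat) (A : 'M[R]_(n, d))
    (p : 'cV[R]_n) : R :=
  L_star A p / mu_star A p.

Definition L_loc (R : realType) (n d : nat) (A : 'M[R]_(n, d))
    (p : 'cV[R]_n) : R :=
  4 * L_star A p.

Definition kappa_loc (R : realType) (n d : nat) (A : 'M[R]_(n, d))
    (p : 'cV[R]_n) : R :=
  9 * kappa A p.

(* The base value 1 is harmless: the weights of a design are at most 1. *)
Definition pmin (R : realType) (n d : nat) (A : 'M[R]_(n, d))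
    (p : 'cV[R]_n) : R :=
  \big[Num.min/1]_(i in contact A p) p i 0.

(* The minimum is taken in the extended reals because [gamma_sc] may be +oo;
   its value is finite. *)
Definition rbar (R : realType) (n d : nat) (A : 'M[R]_(n, d))
    (p : 'cV[R]_n) : R :=
  fine (Order.min (2^-1)%:E
         (Order.min (gamma_sc A p * ((2 * d%:R)^-1)%:E)%E
                    (pmin A p * Num.sqrt (mu_star A p) / 2)%:E)).

Definition zeta (R : realType) (t : R) : R := t - ln (1 + t).

Definition c0 (R : realType) (n d : nat) (A : 'M[R]_(n, d)) (p : 'cV[R]_n) : R :=
  zeta (rbar A p).

Definition sublevel (R : realType) (n d : nat) (A : 'M[R]_(n, d))
    (pstar : 'cV[R]_n) : set 'cV[R]_n :=
  [set p | face_domain A (contact A pstar) p /\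
           fobj A p <= fobj A pstar + c0 A pstar].

(** * FacialNewton *)

(* The oracle is unconstrained outside the positive definite region. *)
Definition leverage_oracle (R : realType) (n d : nat) (A : 'M[R]_(n, d))
    (o : 'cV[R]_n -> 'cV[R]_n) : Prop :=
  forall w, posdef (info A w) -> o w = leverage A w.

(* [NoSolution]: the linear system for the Newton direction is unsolvable. *)
Variant outcome (R : realType) (n : nat) : Type :=
| Returned of 'cV[R]_n
| DampedStep of 'cV[R]_n
| FullStep of 'cV[R]_n
| NoSolution.

Arguments NoSolution {R n}.

Definition is_returned (R : realType) (n : nat) (r : outcome R n) : bool :=
  if r is Returned _ then true else false.
Definition is_damped (R : realType) (n : nat) (r : outcome R n) : bool :=
  if r is DampedStep _ then true else false.
Definition is_full (R : realType) (n : nat) (r : outcome R n) : bool :=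
  if r is FullStep _ then true else false.

Definition newton_system (R : realType) (m : nat) (H : 'M[R]_m) (v : 'cV[R]_m)
    (x : 'cV[R]_m * R) : Prop :=
  H *m x.1 + x.2 *: const_mx 1 = v /\ \sum_k x.1 k 0 = 0.

Definition midpoint (R : realType) (n : nat) (p : 'cV[R]_n) (j : 'I_n) :
    'cV[R]_n :=
  2^-1 *: (p + delta_mx j 0).

(* [ws] lists the answers at the midpoints. *)
Definition queried_hessian (R : realType) (n : nat) (S : {set 'I_n})
    (v : 'cV[R]_n) (ws : seq 'cV[R]_n) : 'M[R]_#|S| :=
  \matrix_(i, j) ((v (enum_val i) 0 - 2^-1 * (ws`_j) (enum_val i) 0)
                  * (1 + v (enum_val j) 0)).

Definition facial_newton_iter (R : realType) (n d : nat) (S : {set 'I_n})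
    (eps : R) (p : 'cV[R]_n) : prog 'cV[R]_n 'cV[R]_n (outcome R n) :=
  Ask p (fun v =>
    if vmax v - d%:R <= eps * d%:R then Ret (Returned p) else
    ask_seq [seq midpoint p (enum_val j) | j <- enum 'I_#|S|] (fun ws =>
      let vS := restrict_to S v in
      match pselect (exists x, newton_system (queried_hessian S v ws) vS x) with
      | left ex =>
          let x := (projT1 (cid ex)).1 in
          let lam := Num.sqrt (\sum_k vS k 0 * x k 0) in
          Ret (if 4^-1 < lam then DampedStep (p + (1 + lam)^-1 *: extend x)
               else FullStep (p + extend x))
      | right _ => Ret NoSolution
      end)).

(* One entry per iteration: the current point, the queries, the outcome. *)
Definition iteration (R : realType) (n : nat) : Type :=
  ('cV[R]_n * seq 'cV[R]_n * outcome R n)%type.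

(* [facial_newton_run o d S eps p tr q]: started at [p], the algorithm goes
   through the iterations [tr] and then returns [q]. *)
Inductive facial_newton_run (R : realType) (n : nat)
    (o : 'cV[R]_n -> 'cV[R]_n) (d : nat) (S : {set 'I_n}) (eps : R) :
    'cV[R]_n -> seq (iteration R n) -> 'cV[R]_n -> Prop :=
| run_return p qs q :
    exec o (facial_newton_iter d S eps p) = (qs, Returned q) ->
    facial_newton_run o d S eps p [:: (p, qs, Returned q)] q
| run_damped p qs p' tr q :
    exec o (facial_newton_iter d S eps p) = (qs, DampedStep p') ->
    facial_newton_run o d S eps p' tr q ->
    facial_newton_run o d S eps p ((p, qs, DampedStep p') :: tr) q
| run_full p qs p' tr q :
    exec o (facial_newton_iter d S eps p) = (qs, FullStep p') ->
    facial_newton_run o d S eps p' tr q ->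
    facial_newton_run o d S eps p ((p, qs, FullStep p') :: tr) q.

Definition total_queries (R : realType) (n : nat) (tr : seq (iteration R n)) :
    nat :=
  \sum_(it <- tr) size it.1.2.

(** * Complexity bounds *)

Definition log2 (R : realType) (x : R) : R := ln x / ln 2.

Definition tau (R : realType) (n d : nat) (A : 'M[R]_(n, d)) (p : 'cV[R]_n)
    (eps : R) : R :=
  Num.min 4^-1
    (eps * d%:R / Num.sqrt (4 / 3 * L_loc A p * kappa_loc A p)).

Definition full_step_bound (R : realType) (n d : nat) (A : 'M[R]_(n, d))
    (p : 'cV[R]_n) (eps : R) : int :=
  Num.max (Num.ceil (log2 (log2 (1 / (2 * tau A p eps))))) 0.

Definition ThetaN (R : realType) (n d : nat) (A : 'M[R]_(n, d))
    (p : 'cV[R]_n) : R :=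
  4 * Num.sqrt (3 * L_star A p * kappa A p) / d%:R.

(* max {1, log log X}.  As [ln] is 0 on nonpositive numbers, this is 1 where
   log log X is undefined. *)
Definition loglog (R : realType) (x : R) : R := Num.max 1 (ln (ln x)).

(* Main.v *)
Require Import Defs.
From HB Require Import structures.
From mathcomp Require Import all_boot all_order all_algebra.
From mathcomp Require Import all_classical all_reals all_analysis.
From mathcomp Require Import ring lra.

Set Implicit Arguments.
Unset Strict Implicit.
Unset Printing Implicit Defensive.

Import Order.TTheory GRing.Theory Num.Theory.
Import numFieldNormedType.Exports.

Local Open Scope classical_set_scope.
Local Open Scope ring_scope.

(* A congruence turns M(p) into the identity and M(x) into a diagonal matrix
   with entries w.  Then f(p + x) = f(p) - sum ln (1 + w), the local norm of x
   at p is the Euclidean norm of w, and every self-concordance estimate reduces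
   to the scalar fact that zeta(t) / t^2 is decreasing.  On the contact set the
   gradient of f at p* is constant, so zeta of the local distance to p* bounds
   f - f* from below; hence the sublevel set lies in a Dikin ball of radius
   rbar, where all weights on S stay positive and v_i <= d outside S.  A damped
   step decreases f by at least zeta(1/4), and 4 zeta(1/4) > zeta(1/2) >= c0
   allows three of them at most.  A full step squares the Newton decrement, and
   decrement tau makes v_i - d <= eps d on S by Cauchy-Schwarz applied to the
   tangent direction e_i - p. *)

(** * Quadratic forms and the spectral theorem *)

(** The Newton decrement is carried from one iterate to the next as an upper bound ([decrement_le]),
    because the norm that measures it changes with the iterate. General self-concordance would bound
    the new decrement only by (l / (1 - l))^2. For the log-determinant the remainder after a Newton
    step is explicit, and measuring it in the norm of the new point gives l^2 with constant one.
    Hence a bound of at most 1/4 persists, no damped step follows a full one, and the two phases can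
    be counted separately. As M(p) and M(p + x) are compared through one diagonalization, the only
    function ever differentiated is the scalar one in [zeta_quotient]. *)

Definition bform (R : realType) (m : nat) (H : 'M[R]_m) (x y : 'cV[R]_m) : R :=
  (x^T *m H *m y) 0 0.

Lemma bformE (R : realType) (m : nat) (H : 'M[R]_m) (x y : 'cV[R]_m) :
  bform H x y = \sum_i \sum_j x i 0 * H i j * y j 0.
Proof.
rewrite /bform mxE exchange_big; apply: eq_bigr => j _.
by rewrite mxE mulr_suml; apply: eq_bigr => i _; rewrite mxE.
Qed.

Lemma bformDl (R : realType) (m : nat) (H : 'M[R]_m) (x y z : 'cV[R]_m) (a : R) :
  bform H (x + a *: y) z = bform H x z + a * bform H y z.
Proof. by rewrite /bform !linearD !linearZ /= !mulmxDl -!scalemxAl !mxE. Qed.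

Lemma bformDr (R : realType) (m : nat) (H : 'M[R]_m) (x y z : 'cV[R]_m) (a : R) :
  bform H z (x + a *: y) = bform H z x + a * bform H z y.
Proof. by rewrite /bform !mulmxDr -!scalemxAr !mxE. Qed.

Lemma bformC (R : realType) (m : nat) (H : 'M[R]_m) (x y : 'cV[R]_m) :
  H^T = H -> bform H x y = bform H y x.
Proof.
move=> sH; rewrite /bform -[in LHS](trmxK (_ *m y)) mxE !trmx_mul trmxK sH.
by rewrite mulmxA.
Qed.

Lemma bform1E (R : realType) (m : nat) (x y : 'cV[R]_m) :
  bform 1%:M x y = \sum_i x i 0 * y i 0.
Proof. by rewrite /bform mulmx1 mxE; apply: eq_bigr => i _; rewrite mxE. Qed.

Lemma bform1_ge0 (R : realType) (m : nat) (x : 'cV[R]_m) : 0 <= bform 1%:M x x.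
Proof. by rewrite bform1E sumr_ge0 // => i _; rewrite -expr2 sqr_ge0. Qed.

Lemma bform1_gt0 (R : realType) (m : nat) (x : 'cV[R]_m) :
  x != 0 -> 0 < bform 1%:M x x.
Proof.
move=> x0; rewrite lt_neqAle bform1_ge0 andbT eq_sym.
apply: contra_neq x0; rewrite bform1E => /eqP.
rewrite psumr_eq0 => [/allP h|i _]; last by rewrite -expr2 sqr_ge0.
apply/colP => i; have := h i (mem_index_enum _).
by rewrite /= -expr2 sqrf_eq0 mxE => /eqP.
Qed.

Lemma continuous_sum_fun (R : realType) (T : topologicalType) (I : Type)
    (s : seq I) (F : I -> T -> R) :
  (forall i, continuous (F i)) -> continuous (fun x => \sum_(i <- s) F i x).
Proof.
move=> cF; elim: s => [|i s IH] x.
  by under eq_fun do rewrite big_nil; exact: cvg_cst.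
by under eq_fun do rewrite big_cons; apply: cvgD; [exact: cF|exact: IH].
Qed.

Lemma continuous_mul_fun (R : realType) (T : topologicalType) (f g : T -> R) :
  continuous f -> continuous g -> continuous (fun x => f x * g x).
Proof. by move=> cf cg x; exact: continuousM (cf x) (cg x). Qed.

(* By compactness of the unit sphere. *)
Lemma bform_min_on (R : realType) (m : nat) (l : 'I_m -> R) (H : 'M[R]_m) :
  (exists x : 'cV[R]_m, \sum_k l k * x k 0 = 0 /\ x != 0) ->
  exists x : 'cV[R]_m, [/\ \sum_k l k * x k 0 = 0, bform 1%:M x x = 1 &
    forall y : 'cV[R]_m, \sum_k l k * y k 0 = 0 ->
      bform H x x * bform 1%:M y y <= bform H y y].
Proof.
move=> [x0 [Tx0 nx0]].
pose K := [set u : 'rV[R]_m | \sum_i u 0 i * u 0 i = 1 /\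
                               \sum_k l k * u 0 k = 0].
pose f (u : 'rV[R]_m) := \sum_i \sum_j u 0 i * H i j * u 0 j.
have coordc (i : 'I_m) : continuous (fun u : 'rV[R]_m => u 0 i).
  exact: coord_continuous.
have fc : continuous f.
  apply: continuous_sum_fun => i; apply: continuous_sum_fun => j.
  apply: continuous_mul_fun; last exact: coordc.
  by apply: continuous_mul_fun; [exact: coordc|exact: cst_continuous].
have normalize (y : 'cV[R]_m) : \sum_k l k * y k 0 = 0 -> y != 0 ->
    K ((Num.sqrt (bform 1%:M y y))^-1 *: y^T).
  move=> Ty ny; set c := _^-1.
  have c2 : c ^+ 2 * bform 1%:M y y = 1.
    by rewrite exprVn sqr_sqrtr ?bform1_ge0 // mulVf // gt_eqF ?bform1_gt0.
  split.
    rewrite -[RHS]c2 bform1E mulr_sumr; apply: eq_bigr => i _.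
    rewrite !mxE; ring.
  rewrite -[RHS](mulr0 c) -[X in _ = _ * X]Ty mulr_sumr; apply: eq_bigr => i _.
  rewrite !mxE; ring.
have Kne : K !=set0.
  by exists ((Num.sqrt (bform 1%:M x0 x0))^-1 *: x0^T); exact: normalize.
have Kc : compact K.
  apply: bounded_closed_compact.
    exists 1; split; first exact: num_real.
    move=> M M1 u [u1 _]; rewrite /= [leLHS]/Num.norm /= mx_normrE.
    apply/bigmax_leP; split; first by lra.
    move=> [i j] _ /=; rewrite (ord1 i).
    apply: le_trans (ltW M1); rewrite -[leRHS]normr1 -ler_sqr ?nnegrE //.
    rewrite -!normrX !ger0_norm ?sqr_ge0 // expr1n -u1 (bigD1 j) //= -expr2 lerDl.
    by apply: sumr_ge0 => k _; rewrite -expr2 sqr_ge0.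
  have -> : K = (fun u : 'rV[R]_m => \sum_i u 0 i * u 0 i) @^-1` [set 1] `&`
             (fun u : 'rV[R]_m => \sum_k l k * u 0 k) @^-1` [set 0].
    by [].
  apply: closedI; apply: closed_comp => /=; try exact: closed_eq.
    move=> u _; apply: continuous_sum_fun => i.
    by apply: continuous_mul_fun; exact: coordc.
  move=> u _; apply: continuous_sum_fun => i.
  by apply: continuous_mul_fun; [exact: cst_continuous|exact: coordc].
have [u uK umin] := compact_EVT_min Kne Kc (continuous_subspaceT fc).
rewrite inE in uK; case: uK => u1 Tu.
have fE (y : 'cV[R]_m) : f y^T = bform H y y.
  by rewrite bformE; apply: eq_bigr => i _; apply: eq_bigr => j _; rewrite !mxE.
exists u^T; split.
- by rewrite -[RHS]Tu; apply: eq_bigr => i _; rewrite mxE.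
- by rewrite bform1E -[RHS]u1; apply: eq_bigr => i _; rewrite mxE.
- move=> y Ty; have [->|ny] := eqVneq y 0.
    by rewrite /bform !mulmx0 [X in _ * X]mxE [leRHS]mxE mulr0.
  have := umin _ (mem_set (normalize y Ty ny)).
  rewrite -fE trmxK => /(@ler_wpM2r _ (bform 1%:M y y) (bform1_ge0 y)) /le_trans; apply.
  have -> : f ((Num.sqrt (bform 1%:M y y))^-1 *: y^T) =
      (bform 1%:M y y)^-1 * bform H y y.
    rewrite (bformE H) mulr_sumr; apply: eq_bigr => i _; rewrite mulr_sumr.
    apply: eq_bigr => j _; rewrite !mxE.
    rewrite -{3}(sqr_sqrtr (bform1_ge0 y)) -exprVn; ring.
  by rewrite mulrC mulrA mulfV ?mul1r // gt_eqF ?bform1_gt0.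
Qed.

(** First-order condition at a constrained minimum: if 2 t b + t^2 q is nonnegative for all t, then
    b = 0. With [l] = 0 this is the eigenvector equation of H, with [l] = 1 that of its compression
    to the tangent space. *)
Lemma bform_min_eigen (R : realType) (m : nat) (l : 'I_m -> R) (H : 'M[R]_m)
    (x : 'cV[R]_m) :
  H^T = H -> \sum_k l k * x k 0 = 0 -> bform 1%:M x x = 1 ->
  (forall y : 'cV[R]_m, \sum_k l k * y k 0 = 0 ->
     bform H x x * bform 1%:M y y <= bform H y y) ->
  forall y : 'cV[R]_m, \sum_k l k * y k 0 = 0 ->
    bform H y x = bform H x x * bform 1%:M y x.
Proof.
move=> sH Tx x1 xmin y Ty; set a := bform H x x.
pose b := bform H y x - a * bform 1%:M y x.
pose q := bform H y y - a * bform 1%:M y y.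
have key t : 0 <= 2 * t * b + t ^+ 2 * q.
  have := xmin (x + t *: y).
  have -> : \sum_k l k * (x + t *: y) k 0 = 0.
    rewrite -[RHS]addr0 -[X in _ = X + _]Tx -[X in _ = _ + X](mulr0 t).
    rewrite -[X in _ = _ + _ * X]Ty mulr_sumr -big_split.
    by apply: eq_bigr => i _; rewrite !mxE /=; ring.
  move=> /(_ erefl); rewrite !(bformDl, bformDr) x1 -/a.
  rewrite (bformC x y sH) (bformC x y (trmx1 _ _)) /b /q -subr_ge0.
  by move=> /le_trans; apply; rewrite le_eqVlt; apply/orP; left; apply/eqP; ring.
have q0 : 0 <= q by rewrite subr_ge0 xmin.
suff b0 : b = 0 by apply/eqP; rewrite -subr_eq0 -/b b0.
apply/eqP; rewrite -sqrf_eq0 eq_le sqr_ge0 andbT.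
(* The minimizing t would be - b / q; adding 1 covers q = 0. *)
have := key (- b / (q + 1)).
have q1 : 0 < q + 1 by lra.
have -> : 2 * (- b / (q + 1)) * b + (- b / (q + 1)) ^+ 2 * q
  = - (b ^+ 2 * ((q + 2) / (q + 1) ^+ 2)) by field; rewrite gt_eqF.
rewrite oppr_ge0 pmulr_lle0 //; apply: divr_gt0; first by lra.
by rewrite exprn_gt0.
Qed.

(** The Householder reflection along v = x - e exchanges e and x. Since v^T v = 2 (1 - c), its
    coefficient 2 / v^T v is 1 / (1 - c). For x = e there is no direction to reflect along, and the
    identity serves. *)
Lemma orthogonal_first_col (R : realType) (m : nat) (x : 'cV[R]_(1 + m)) :
  x^T *m x = 1%:M ->
  exists U : 'M[R]_(1 + m), U^T *m U = 1%:M /\ U *m delta_mx 0 0 = x.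
Proof.
move=> x1; set e : 'cV[R]_(1 + m) := delta_mx 0 0.
have [->|nx] := eqVneq x e.
  by exists 1%:M; rewrite trmx1 !mul1mx.
set v := x - e; have v0 : v != 0 by rewrite subr_eq0.
have scal (y z : 'cV[R]_(1 + m)) : y^T *m z = (bform 1%:M y z)%:M.
  by rewrite /bform mulmx1 -mx11_scalar.
have ee : bform 1%:M e e = 1.
  by rewrite /bform mulmx1 trmx_delta mul_delta_mx mxE.
have xx : bform 1%:M x x = 1 by rewrite /bform mulmx1 x1 mxE.
set c := bform 1%:M e x.
have vE : v = x + (-1) *: e by rewrite scaleN1r.
have vx : e + v = x by rewrite /v subrKC.
clearbody v.
have vv : bform 1%:M v v = 2 * (1 - c).
  rewrite vE !(bformDl, bformDr) ee xx (bformC x e (trmx1 _ _)) -/c; ring.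
have ve : bform 1%:M v e = - (1 - c).
  rewrite vE !(bformDl, bformDr) ee (bformC x e (trmx1 _ _)) -/c; ring.
have c1 : 0 < 1 - c.
  by have := bform1_gt0 v0; rewrite vv; lra.
pose U : 'M[R]_(1 + m) := 1%:M - (1 - c)^-1 *: (v *m v^T).
have UT : U^T = U.
  by rewrite /U linearB linearZ /= trmx1 trmx_mul trmxK.
exists U; split.
  have WW : (v *m v^T) *m (v *m v^T) = (2 * (1 - c)) *: (v *m v^T).
    by rewrite mulmxA -(mulmxA v) scal vv mul_mx_scalar scalemxAl.
  rewrite UT /U mulmxBr mulmx1 -scalemxAr mulmxBl mul1mx -scalemxAl WW.
  rewrite scalerA scalerBr scalerA -addrA -opprD -[RHS]subr0; congr (_ - _).
  rewrite addrC -scalerBl -scalerDl -[RHS](scale0r (v *m v^T)); congr (_ *: _).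
  by field; rewrite gt_eqF.
rewrite /U mulmxBl mul1mx -scalemxAl -mulmxA scal ve mul_mx_scalar scalerA.
by rewrite mulrN mulVf ?gt_eqF // scaleN1r opprK.
Qed.

Lemma symmetric_eigenvector (R : realType) (m : nat) (H : 'M[R]_m) :
  (0 < m)%N -> H^T = H ->
  exists (x : 'cV[R]_m) (a : R), x^T *m x = 1%:M /\ H *m x = a *: x.
Proof.
move=> m0 sH.
have T0 (y : 'cV[R]_m) : \sum_k (fun=> 0) k * y k 0 = 0.
  by rewrite big1 // => k _; rewrite mul0r.
have [|x [_ x1 xmin]] := @bform_min_on R m (fun=> 0) H.
  exists (delta_mx (Ordinal m0) 0); split; first exact: T0.
  apply/eqP => /matrixP /(_ (Ordinal m0) 0); rewrite !mxE !eqxx.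
  by move/eqP; rewrite oner_eq0.
exists x, (bform H x x); split.
  by rewrite [LHS]mx11_scalar -[x^T]mulmx1 -/(bform _ _ _) x1.
apply/colP => i.
have := bform_min_eigen sH (T0 _) x1 xmin (T0 (delta_mx i 0)).
rewrite /bform mulmx1 -mulmxA trmx_delta -!rowE ![(row _ _) _ _]mxE => ->.
by rewrite [RHS]mxE.
Qed.

(** Deflation: once an eigenvector is moved to the first basis vector, symmetry clears the first row
    along with the first column, and induction handles the remaining block. *)
Lemma spectral_symmetric (R : realType) (m : nat) (H : 'M[R]_m) :
  H^T = H -> exists (Q : 'M[R]_m) (e : 'rV[R]_m),
    Q^T *m Q = 1%:M /\ Q^T *m H *m Q = diag_mx e.
Proof.
elim: m H => [|m IH] H sH.
  by exists 1%:M, 0; split; apply/matrixP => -[].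
move: H sH; rewrite -[m.+1]/(1 + m)%N => H sH.
have [//|x [a [x1 Hx]]] := symmetric_eigenvector _ sH.
have [U [UU Ue]] := orthogonal_first_col x1.
set H' := U^T *m H *m U.
have sH' : H'^T = H' by rewrite /H' !trmx_mul trmxK sH mulmxA.
have H'0 : U^T *m H *m U = H' by [].
have He : H' *m delta_mx 0 0 = a *: delta_mx 0 0 :> 'cV[R]_(1 + m).
  by rewrite /H' -!mulmxA Ue Hx -scalemxAr -Ue mulmxA UU mul1mx.
clearbody H'.
have Hi0 i : H' i 0 = a * (i == 0)%:R.
  have := congr1 (fun z : 'cV[R]_(1 + m) => z i 0) He.
  by rewrite /= -colE !mxE eqxx andbT.
have H'E : H' = block_mx a%:M 0 0 (drsubmx H').
  rewrite -[LHS]submxK; congr block_mx.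
  - apply/matrixP => i j; rewrite !ord1 !mxE lshift0 Hi0 eqxx mulr1.
    by rewrite mulr1n.
  - apply/matrixP => i j; rewrite !ord1 !mxE -sH' mxE lshift0 Hi0.
    by rewrite -(lshift0 _ 0) eq_rlshift mulr0.
  - apply/matrixP => i j; rewrite !ord1 !mxE lshift0 Hi0.
    by rewrite -(lshift0 _ 0) eq_rlshift mulr0.
have [|Q [e [QQ Qe]]] := IH (drsubmx H').
  by rewrite -[in RHS]sH' trmx_drsub.
exists (U *m block_mx 1%:M 0 0 Q), (row_mx a%:M e); split.
  rewrite trmx_mul mulmxA -(mulmxA _ U^T) UU mulmx1 tr_block_mx mulmx_block.
  by rewrite !trmx0 !trmx1 !(mulmx0, mul0mx, mul1mx, addr0, add0r) QQ -scalar_mx_block.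
rewrite trmx_mul !mulmxA -(mulmxA _ U^T) -(mulmxA _ _ U) H'0 H'E.
rewrite tr_block_mx !mulmx_block.
rewrite !trmx0 !trmx1 !(mulmx0, mul0mx, mul1mx, addr0, add0r, mulmx1) Qe.
rewrite diag_mx_row; congr block_mx.
by apply/matrixP => i j; rewrite !ord1 !mxE.
Qed.

(** Rescaling the eigenvectors of M turns M into the identity, which the orthogonal matrix
    diagonalizing the transformed N leaves unchanged. *)
Lemma simultaneous_diagonalization (R : realType) (d : nat) (M N : 'M[R]_d) :
  posdef M -> N^T = N -> exists (P : 'M[R]_d) (w : 'rV[R]_d),
    [/\ P \in unitmx, P^T *m M *m P = 1%:M & P^T *m N *m P = diag_mx w].
Proof.
move=> [sM pM] sN; have [Q [e [QQ Qe]]] := spectral_symmetric sM.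
have e0 k : 0 < e 0 k.
  pose u : 'cV[R]_d := delta_mx k 0.
  have -> : e 0 k = ((Q *m u)^T *m M *m (Q *m u)) 0 0.
    have -> : (Q *m u)^T *m M *m (Q *m u) = u^T *m (Q^T *m M *m Q) *m u.
      by rewrite trmx_mul !mulmxA.
    by rewrite Qe trmx_delta -colE -rowE !mxE eqxx.
  apply: pM; apply/eqP => /(congr1 (mulmx Q^T)); rewrite mulmxA QQ mul1mx mulmx0.
  by move/matrixP => /(_ k 0); rewrite !mxE !eqxx => /eqP; rewrite oner_eq0.
pose D := diag_mx (\row_k (Num.sqrt (e 0 k))^-1).
pose P0 := Q *m D.
have M1 : P0^T *m M *m P0 = 1%:M.
  rewrite /P0 trmx_mul !mulmxA -(mulmxA _ _ M) -(mulmxA _ _ Q) Qe.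
  rewrite /D tr_diag_mx !mulmx_diag -diag_const_mx; congr diag_mx.
  apply/rowP => k; rewrite !mxE -{2}(sqr_sqrtr (ltW (e0 k))).
  by field; rewrite gt_eqF // sqrtr_gt0.
clearbody P0.
have sN' : (P0^T *m N *m P0)^T = P0^T *m N *m P0.
  by rewrite !trmx_mul trmxK sN mulmxA.
have [Q' [w [QQ' Qw]]] := spectral_symmetric sN'.
exists (P0 *m Q'), w.
have M2 : (P0 *m Q')^T *m M *m (P0 *m Q') = 1%:M.
  by rewrite trmx_mul -[RHS]QQ' -[X in _ = X *m _]mulmx1 -M1 !mulmxA.
split => //.
  by case: (mulmx1_unit M2).
by rewrite -Qw trmx_mul !mulmxA.
Qed.

(** * The function zeta *)

Lemma zeta0 (R : realType) : zeta 0 = 0 :> R.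
Proof. by rewrite /zeta addr0 ln1 subrr. Qed.

(* [zeta x / x^2] is the integral of [t / (1 + t x)] over [0, 1], hence
   decreasing in x; the proof compares the two sides along the rays [t a] and
   [t b]. *)
Lemma zeta_quotient (R : realType) (a b : R) :
  -1 < a -> a <= b -> a ^+ 2 * zeta b <= b ^+ 2 * zeta a.
Proof.
move=> a1 ab.
have b1 : -1 < b by lra.
(* [F 0] = 0 and [F 1] is the difference of the two sides, so it suffices that F is nondecreasing on
   [0, 1]. *)
pose F (t : R) := b ^+ 2 * (t * a - ln (1 + t * a))
               - a ^+ 2 * (t * b - ln (1 + t * b)).
have pos (c t : R) : -1 < c -> 0 <= t <= 1 -> 0 < 1 + t * c.
  move=> c1 t01; have ht : 0 <= t * (1 + c) by apply: mulr_ge0; lra.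
  (* Write 1 + t c as (1 - t) + t (1 + c): the first summand is positive for t <= 1/2, the second
     for t > 1/2. *)
  have [|t2] := lerP t 2^-1; first by lra.
  have : 0 < t * (1 + c) by apply: mulr_gt0; lra.
  by lra.
have dF (t : R) : 0 <= t <= 1 -> is_derive t 1 F
    (b ^+ 2 * (a - a * (1 + t * a)^-1) - a ^+ 2 * (b - b * (1 + t * b)^-1)).
  move=> t01.
  have dln (c : R) : -1 < c ->
      is_derive t 1 (fun t : R => ln (1 + t * c)) (c * (1 + t * c)^-1).
    move=> c1; have h := is_derive1_ln (pos c t c1 t01).
    have h2 : is_derive t 1 (fun t : R => 1 + t * c) c.
      by apply: is_derive_eq; rewrite /GRing.scale /=; ring.
    have := @is_derive1_comp R (@ln R) (fun t : R => 1 + t * c) t _ _ h h2.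
    by rewrite mulrC.
  have dz (c : R) : -1 < c ->
      is_derive t 1 (fun t : R => t * c - ln (1 + t * c))
        (c - c * (1 + t * c)^-1).
    move=> c1; apply: is_deriveB; last exact: dln.
    by apply: is_derive_eq; rewrite /GRing.scale /=; ring.
  by apply: is_deriveB; apply: is_deriveZ; exact: dz.
have dF' (t : R) : 0 <= t <= 1 -> derivable F t 1.
  by move=> /dF [].
have F'0 (x : R) : x \in `]0, 1[%R -> 0 <= derive1 F x.
  rewrite in_itv /= => /andP[x0 x1].
  have x01 : 0 <= x <= 1 by lra.
  rewrite derive1E (@derive_val _ _ _ _ _ _ _ (dF x x01)).
  have pa := pos a x a1 x01; have pb := pos b x b1 x01.
  have -> : b ^+ 2 * (a - a * (1 + x * a)^-1) - a ^+ 2 * (b - b * (1 + x * b)^-1)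
    = a ^+ 2 * b ^+ 2 * x * (x * (b - a)) / ((1 + x * a) * (1 + x * b)).
    by field; rewrite !gt_eqF.
  apply: divr_ge0; last by rewrite mulr_ge0 ?ltW.
  have ab0 : 0 <= a ^+ 2 * b ^+ 2 by rewrite mulr_ge0 ?sqr_ge0.
  have bx0 : 0 <= x * (b - a) by rewrite mulr_ge0 ?subr_ge0 // ltW.
  by rewrite mulr_ge0 // mulr_ge0 // ltW.
have cF : {within `[0, 1], continuous F}.
  apply: derivable_within_continuous => x; rewrite in_itv /= => x01.
  exact: dF'.
have dFo (x : R) : x \in `]0, 1[%R -> derivable F x 1.
  by rewrite in_itv /= => /andP[x0 x1]; apply: dF'; lra.
have F01 : F 0 <= F 1 := ger0_derive1_ndecr dFo F'0 cF (lexx 0) ler01 (lexx 1).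
move: F01; rewrite /F !mul0r !mul1r addr0 ln1 !subr0 !mulr0 subr0 subr_ge0.
by rewrite /zeta.
Qed.

(** The logarithm lies strictly below its tangent at 1 + a, whose slope is at most 1. *)
Lemma zeta_lt (R : realType) (a b : R) : 0 <= a -> a < b -> zeta a < zeta b.
Proof.
move=> a0 ab; rewrite /zeta.
have u0 : 0 < (b - a) / (1 + a) by apply: divr_gt0; lra.
have h : ln (1 + b) - ln (1 + a) < (b - a) / (1 + a).
  rewrite -ln_div ?posrE; [|lra..].
  have -> : (1 + b) / (1 + a) = 1 + (b - a) / (1 + a).
    by field; rewrite gt_eqF //; lra.
  rewrite -[ltRHS]expRK ltr_ln ?posrE ?expR_gt0 ?expR_gt1Dx ?gt_eqF //; lra.
have : (b - a) / (1 + a) <= b - a by rewrite ler_pdivrMr; nra.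
lra.
Qed.

Lemma zeta_ge0 (R : realType) (t : R) : 0 <= t -> 0 <= zeta t.
Proof.
rewrite le_eqVlt => /orP[/eqP <-|t0]; first by rewrite zeta0.
by rewrite -zeta0 ltW // zeta_lt.
Qed.

(** After exponentiation the claim is 625/384 < sqrt e, roughly 1.628 < 1.649. From exp x >= 1 + x
    at x = 1/32 one gets sqrt e >= (33/32)^16, about 1.636; x = 1/16 would give only 1.624. *)
Lemma zeta_half_quarter (R : realType) : zeta 2^-1 < 4 * zeta 4^-1 :> R.
Proof.
rewrite /zeta.
have n0 : (1 + 4^-1) ^+ 4 / (1 + 2^-1) < (33 / 32) ^+ 16 :> R.
  have -> : (1 + 4^-1) ^+ 4 / (1 + 2^-1) = 625 / 384 :> R by field.
  by lra.
have e0 : (33 / 32) ^+ 16 <= expR 2^-1 :> R.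
  have -> : 2^-1 = 16%:R * (1 / 32) :> R by lra.
  rewrite expRM_natl; apply: lerXn2r; rewrite ?nnegrE ?expR_ge0 //.
  by apply: le_trans (expR_ge1Dx _); lra.
have h : 4 * ln (1 + 4^-1) - ln (1 + 2^-1) < 2^-1 :> R.
  rewrite -[ltRHS]expRK mulr_natl -lnXn ?posrE; last by lra.
  rewrite -ln_div ?posrE; [|by apply: exprn_gt0; lra|lra].
  rewrite ltr_ln ?posrE ?expR_gt0 //.
  exact: lt_le_trans n0 e0.
lra.
Qed.

(** By [zeta_quotient] the ratio of zeta (- t) to t^2 is largest at t = 1/4. There the claim is ln
    (4/3) <= 5/16, which follows from exp (5/16) >= (37/32)^2 > 4/3. *)
Lemma zeta_opp_le (R : realType) (t : R) :
  0 <= t <= 4^-1 -> zeta (- t) <= t ^+ 2.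
Proof.
move=> /andP[t0 t4].
have z4 : zeta (- 4^-1) <= 4^-1 ^+ 2 :> R.
  have e0 : (1 + 5 / 32) ^+ 2 <= expR (5 / 16) :> R.
    have -> : 5 / 16 = 2%:R * (5 / 32) :> R by lra.
    rewrite expRM_natl; apply: lerXn2r; rewrite ?nnegrE ?expR_ge0 ?expR_ge1Dx //.
  have h : - ln (1 - 4^-1) <= 5 / 16 :> R.
    rewrite -lnV ?posrE; last by lra.
    rewrite -[leRHS]expRK ler_ln ?posrE ?expR_gt0 ?invr_gt0; [|by lra..].
    apply: le_trans e0; have -> : (1 - 4^-1)^-1 = 4 / 3 :> R by field.
    by lra.
  by rewrite /zeta; lra.
have := @zeta_quotient R (- 4^-1) (- t); rewrite !sqrrN => /(_ _ _)/le_trans h.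
have : 4^-1 ^+ 2 * zeta (- t) <= 4^-1 ^+ 2 * t ^+ 2.
  rewrite [leRHS]mulrC; apply: h; [lra..|].
  by rewrite ler_wpM2l // sqr_ge0.
by rewrite ler_pM2l // exprn_gt0.
Qed.

(** No e k exceeds the Euclidean norm r, so zeta (e k) >= (e k / r)^2 zeta r, and these weights add
    up to 1. *)
Lemma sum_zeta_ge (R : realType) (d : nat) (e : 'I_d -> R) :
  (forall k, -1 < e k) ->
  zeta (Num.sqrt (\sum_k e k ^+ 2)) <= \sum_k zeta (e k).
Proof.
move=> e1; set r := Num.sqrt _.
have s0 : 0 <= \sum_k e k ^+ 2 by apply: sumr_ge0 => k _; exact: sqr_ge0.
have r2 : r ^+ 2 = \sum_k e k ^+ 2 by rewrite sqr_sqrtr.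
have er k : `|e k| <= r.
  rewrite -sqrtr_sqr ler_wsqrtr // (bigD1 k) //= lerDl.
  by apply: sumr_ge0 => i _; exact: sqr_ge0.
have [r0|rn] := eqVneq r 0.
  rewrite r0 zeta0 big1 // => k _; have := er k.
  by rewrite r0 normr_le0 => /eqP ->; rewrite zeta0.
have rp : 0 < r ^+ 2 by rewrite exprn_even_gt0 //=.
rewrite -(ler_pM2l rp) {1}r2 mulr_suml mulr_sumr; apply: ler_sum => k _.
apply: zeta_quotient => //; exact: le_trans (ler_norm _) (er k).
Qed.

(** The same weights, now with - r <= e k; r < 1 keeps - r in the domain of [zeta_quotient]. *)
Lemma sum_zeta_le (R : realType) (d : nat) (e : 'I_d -> R) :
  let r := Num.sqrt (\sum_k e k ^+ 2) in r < 1 ->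
  \sum_k zeta (e k) <= zeta (- r).
Proof.
move=> r r1.
have s0 : 0 <= \sum_k e k ^+ 2 by apply: sumr_ge0 => k _; exact: sqr_ge0.
have r2 : r ^+ 2 = \sum_k e k ^+ 2 by rewrite sqr_sqrtr.
have er k : `|e k| <= r.
  rewrite -sqrtr_sqr ler_wsqrtr // (bigD1 k) //= lerDl.
  by apply: sumr_ge0 => i _; exact: sqr_ge0.
have [r0|rn] := eqVneq r 0.
  rewrite r0 oppr0 zeta0 big1 // => k _; have := er k.
  by rewrite r0 normr_le0 => /eqP ->; rewrite zeta0.
have rp : 0 < r ^+ 2 by rewrite exprn_even_gt0 //=.
rewrite -(ler_pM2l rp) [leRHS](_ : _ = \sum_k e k ^+ 2 * zeta (- r)); last first.
  by rewrite r2 mulr_suml.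
rewrite mulr_sumr; apply: ler_sum => k _.
rewrite -(sqrrN r); apply: zeta_quotient; first by lra.
by have := er k; rewrite ler_norml => /andP[].
Qed.

(** * Local geometry of the log-determinant *)

Definition gram (R : realType) (n d : nat) (A : 'M[R]_(n, d)) (p : 'cV[R]_n) :
    'M[R]_n :=
  A *m invmx (info A p) *m A^T.

(* Derivative of [- fobj] at p in the direction x. *)
Definition dlogdet (R : realType) (n d : nat) (A : 'M[R]_(n, d))
    (p x : 'cV[R]_n) : R :=
  \sum_i x i 0 * leverage A p i 0.

(* Second derivative of [fobj] at p. *)
Definition hess (R : realType) (n d : nat) (A : 'M[R]_(n, d))
    (p x y : 'cV[R]_n) : R :=
  \sum_i \sum_j x i 0 * y j 0 * gram A p i j ^+ 2.

Definition lnorm (R : realType) (n d : nat) (A : 'M[R]_(n, d))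
    (p x : 'cV[R]_n) : R :=
  Num.sqrt (hess A p x x).

Lemma gramE (R : realType) (n d : nat) (A : 'M[R]_(n, d)) (p : 'cV[R]_n) i j :
  gram A p i j = (row i A *m invmx (info A p) *m (row j A)^T) 0 0.
Proof.
rewrite /gram [LHS]mxE [RHS]mxE; apply: eq_bigr => k _; rewrite -row_mul.
by rewrite [in RHS]mxE [in LHS]mxE ![in RHS]mxE; congr (_ * _); rewrite mxE.
Qed.

Lemma leverageE (R : realType) (n d : nat) (A : 'M[R]_(n, d)) (p : 'cV[R]_n) i :
  leverage A p i 0 = gram A p i i.
Proof. by rewrite gramE mxE. Qed.

Lemma infoE (R : realType) (n d : nat) (A : 'M[R]_(n, d)) (p : 'cV[R]_n) k l :
  info A p k l = \sum_i p i 0 * (A i k * A i l).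
Proof.
rewrite /info summxE; apply: eq_bigr => i _.
by rewrite !mxE big_ord1 !mxE.
Qed.

Lemma infoD (R : realType) (n d : nat) (A : 'M[R]_(n, d)) (p q : 'cV[R]_n) :
  info A (p + q) = info A p + info A q.
Proof.
by rewrite /info -big_split; apply: eq_bigr => i _; rewrite mxE scalerDl.
Qed.

Lemma infoZ (R : realType) (n d : nat) (A : 'M[R]_(n, d)) (a : R)
    (p : 'cV[R]_n) :
  info A (a *: p) = a *: info A p.
Proof.
by rewrite /info scaler_sumr; apply: eq_bigr => i _; rewrite mxE scalerA.
Qed.

Lemma info_sym (R : realType) (n d : nat) (A : 'M[R]_(n, d)) (p : 'cV[R]_n) :
  (info A p)^T = info A p.
Proof.
apply/matrixP => k l; rewrite mxE !infoE; apply: eq_bigr => i _.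
by rewrite (mulrC (A i l)).
Qed.

Lemma info_mulmx (R : realType) (n d : nat) (A : 'M[R]_(n, d)) (P : 'M[R]_d)
    (p : 'cV[R]_n) :
  info (A *m P) p = P^T *m info A p *m P.
Proof.
rewrite /info mulmx_sumr mulmx_suml; apply: eq_bigr => i _.
by rewrite -scalemxAr -scalemxAl row_mul trmx_mul !mulmxA.
Qed.

Lemma invmx_congruence (R : realType) (d : nat) (M P : 'M[R]_d) (c : 'rV[R]_d) :
  P \in unitmx -> P^T *m M *m P = diag_mx c -> (forall k, c 0 k != 0) ->
  invmx M = P *m diag_mx (\row_k (c 0 k)^-1) *m P^T.
Proof.
move=> uP Pc c0; set N := _ *m P^T.
have PT : P^T \in unitmx by rewrite unitmx_tr.
have MN : M *m N = 1%:M.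
  apply: (can_inj (mulKmx PT)); rewrite mulmx1 /N !mulmxA Pc mulmx_diag.
  rewrite [diag_mx _](_ : _ = 1%:M) ?mul1mx // -diag_const_mx; congr diag_mx.
  by apply/rowP => k; rewrite !mxE mulfV.
by have [uM _] := mulmx1_unit MN; rewrite -[RHS](mulKmx uM) MN mulmx1.
Qed.

Lemma ln_prod_gt0 (R : realType) (I : finType) (F : I -> R) :
  (forall i, 0 < F i) -> ln (\prod_i F i) = \sum_i ln (F i).
Proof.
move=> F0; suff [] : 0 < \prod_i F i /\ ln (\prod_i F i) = \sum_i ln (F i) by [].
elim/big_rec2: _ => [|i y x _ [x0 <-]]; first by rewrite ln1.
by rewrite mulr_gt0 // lnM ?posrE.
Qed.

(* Coordinates in which M(p) is the identity and M(x) is diagonal; B plays the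
   role of the design matrix. *)
Lemma diagonal_coordinates (R : realType) (n d : nat) (A : 'M[R]_(n, d))
    (p x : 'cV[R]_n) :
  posdef (info A p) -> exists (B : 'M[R]_(n, d)) (w : 'I_d -> R),
    [/\ info B p = 1%:M,
        forall k l, info B x k l = w k *+ (k == l),
        forall y, info B y = 0 -> info A y = 0,
        forall i j, gram A p i j = \sum_k 1 * (B i k * B j k) &
        (posdef (info A (p + x)) <-> forall k, -1 < w k) /\
        ((forall k, -1 < w k) ->
           (forall i j,
              gram A (p + x) i j = \sum_k (1 + w k)^-1 * (B i k * B j k)) /\
           fobj A (p + x) = fobj A p - \sum_k ln (1 + w k))].
Proof.
move=> pd; have [P [w [uP P1 Pw]]] := simultaneous_diagonalization pd (info_sym A x).
have uPT : P^T \in unitmx by rewrite unitmx_tr.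
have gramP (q : 'cV[R]_n) (c : 'rV[R]_d) : P^T *m info A q *m P = diag_mx c ->
    (forall k, c 0 k != 0) -> forall i j,
    gram A q i j = \sum_k (c 0 k)^-1 * ((A *m P) i k * (A *m P) j k).
  move=> Pc c0 i j; rewrite /gram (invmx_congruence uP Pc c0).
  rewrite !mulmxA -mulmxA -trmx_mul mxE; apply: eq_bigr => k _.
  by rewrite mul_mx_diag [X in X * _]mxE [X in _ * X]mxE [X in _ * X * _]mxE; ring.
have Pc : P^T *m info A (p + x) *m P = diag_mx (\row_k (1 + w 0 k)).
  rewrite infoD mulmxDr mulmxDl P1 Pw -diag_const_mx -linearD /=.
  by congr diag_mx; apply/rowP => k; rewrite !mxE.
exists (A *m P), (fun k => w 0 k); split.
- by rewrite info_mulmx.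
- by move=> k l; rewrite info_mulmx Pw mxE.
- move=> y; rewrite info_mulmx => y0.
  rewrite -[info A y](mulKmx uPT) -[_ *m info A y](mulmxK uP) y0.
  by rewrite mul0mx mulmx0.
- move=> i j; rewrite (gramP p (const_mx 1)) ?diag_const_mx //.
    by apply: eq_bigr => k _; rewrite mxE invr1.
  by move=> k; rewrite mxE oner_eq0.
split.
  split=> [[_ pq] k|w1].
    pose u : 'cV[R]_d := delta_mx k 0.
    have : 0 < ((P *m u)^T *m info A (p + x) *m (P *m u)) 0 0.
      apply: pq; apply/eqP => /(congr1 (mulmx (invmx P))); rewrite mulKmx // mulmx0.
      by move/matrixP => /(_ k 0); rewrite !mxE !eqxx => /eqP; rewrite oner_eq0.
    have -> : (P *m u)^T *m info A (p + x) *m (P *m u)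
        = u^T *m (P^T *m info A (p + x) *m P) *m u by rewrite trmx_mul !mulmxA.
    by rewrite Pc trmx_delta -colE -rowE !mxE eqxx mulr1n; lra.
  split; first exact: info_sym.
  move=> z z0; rewrite -[z](mulKVmx uP); set y := invmx P *m z.
  have y0 : y != 0.
    by apply: contra_neq z0 => y0; rewrite -[z](mulKVmx uP) -/y y0 mulmx0.
  have -> : (P *m y)^T *m info A (p + x) *m (P *m y)
        = y^T *m (P^T *m info A (p + x) *m P) *m y by rewrite trmx_mul !mulmxA.
  rewrite Pc mul_mx_diag mxE.
  have [k yk] : exists k, y k 0 != 0.
    apply/existsP; rewrite -negb_forall; apply: contra_neqN y0 => /forallP h.
    by apply/colP => k; rewrite [RHS]mxE; apply/eqP/h.
  have tE j : (\matrix_(i, j) (y^T i j * (\row_k (1 + w 0 k)) 0 j)) 0 j * y j 0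
      = (1 + w 0 j) * y j 0 ^+ 2 by rewrite !mxE; ring.
  rewrite (bigD1 k) //= ltr_wpDr //.
    apply: sumr_ge0 => j _; rewrite tE mulr_ge0 ?sqr_ge0 //.
    by have := w1 j; lra.
  rewrite tE mulr_gt0 //; first by have := w1 k; lra.
  by rewrite exprn_even_gt0.
move=> w1; have w0 k : 0 < 1 + w 0 k by have := w1 k; lra.
split.
  move=> i j; rewrite (gramP _ _ Pc) => [|k]; last by rewrite mxE gt_eqF.
  by apply: eq_bigr => k _; rewrite mxE.
(* The factor [\det P ^+ 2] is common to both points, so only the ratio, the product of the 1 + w k,
   enters the logarithm. *)
have dp : \det P ^+ 2 * \det (info A p) = 1.
  have := congr1 determinant P1; rewrite !det_mulmx det_tr det1 => <-; ring.
have dq : \det P ^+ 2 * \det (info A (p + x)) = \prod_k (1 + w 0 k).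
  have := congr1 determinant Pc; rewrite !det_mulmx det_tr det_diag => h.
  rewrite [RHS](_ : _ = \prod_i (\row_k (1 + w 0 k)) 0 i); last first.
    by apply: eq_bigr => k _; rewrite mxE.
  rewrite -h; ring.
have P0 : 0 < \det P ^+ 2.
  by rewrite exprn_even_gt0 //= -unitfE -unitmxE.
have d0 : 0 < \det (info A p) by rewrite -(pmulr_rgt0 _ P0) dp.
have -> : fobj A (p + x) = - ln (\det (info A p) * \prod_k (1 + w 0 k)).
  rewrite /fobj; congr (- ln _).
  by rewrite -dq mulrA [_ * _ ^+ 2]mulrC dp mul1r.
rewrite lnM ?posrE ?prodr_gt0 // ln_prod_gt0 // opprD.
by [].
Qed.

(** The weights c are arbitrary so that the formula serves both at p, with c = 1, and at p + x, with
    c k = 1 / (1 + w k). This is why [diagonal_coordinates] keeps a factor [1 *]. *)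
Lemma dlogdet_coords (R : realType) (n d : nat) (A B : 'M[R]_(n, d))
    (p y : 'cV[R]_n) (c : 'I_d -> R) :
  (forall i j, gram A p i j = \sum_k c k * (B i k * B j k)) ->
  dlogdet A p y = \sum_k c k * info B y k k.
Proof.
move=> gE; rewrite /dlogdet.
under eq_bigr => i _ do rewrite leverageE gE mulr_sumr.
rewrite exchange_big; apply: eq_bigr => k _; rewrite infoE mulr_sumr.
by apply: eq_bigr => i _; ring.
Qed.

(** The Hessian is the trace of M(p)^-1 M(y) M(p)^-1 M(z), written in coordinates where M(p)^-1 is
    diagonal. *)
Lemma hess_coords (R : realType) (n d : nat) (A B : 'M[R]_(n, d))
    (p y z : 'cV[R]_n) (c : 'I_d -> R) :
  (forall i j, gram A p i j = \sum_k c k * (B i k * B j k)) ->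
  hess A p y z = \sum_k \sum_l c k * c l * (info B y k l * info B z k l).
Proof.
move=> gE; rewrite /hess.
transitivity (\sum_i \sum_j \sum_k \sum_l
   y i 0 * z j 0 * (c k * (B i k * B j k)) * (c l * (B i l * B j l))).
  apply: eq_bigr => i _; apply: eq_bigr => j _.
  rewrite gE expr2 mulr_suml mulr_sumr; apply: eq_bigr => k _.
  by rewrite !mulr_sumr; apply: eq_bigr => l _; ring.
transitivity (\sum_k \sum_l \sum_i \sum_j
   y i 0 * z j 0 * (c k * (B i k * B j k)) * (c l * (B i l * B j l))).
  under eq_bigr => i _ do rewrite exchange_big /=.
  rewrite exchange_big /=; apply: eq_bigr => k _.
  under eq_bigr => i _ do rewrite exchange_big /=.
  by rewrite exchange_big.
apply: eq_bigr => k _; apply: eq_bigr => l _; rewrite !infoE.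
rewrite mulr_suml mulr_sumr; apply: eq_bigr => i _.
rewrite !mulr_sumr; apply: eq_bigr => j _; ring.
Qed.

Lemma cauchy_schwarz_sum (R : realType) (I : finType) (f g : I -> R) :
  \sum_i f i * g i <=
  Num.sqrt (\sum_i f i ^+ 2) * Num.sqrt (\sum_i g i ^+ 2).
Proof.
have sq0 (h : I -> R) : 0 <= \sum_i h i ^+ 2.
  by apply: sumr_ge0 => i _; exact: sqr_ge0.
have zero (h : I -> R) : Num.sqrt (\sum_i h i ^+ 2) = 0 -> forall i, h i = 0.
  move=> /eqP; rewrite sqrtr_eq0 => s0 i; apply/eqP; rewrite -sqrf_eq0.
  rewrite eq_le sqr_ge0 andbT (le_trans _ s0) // (bigD1 i) //= lerDl.
  by apply: sumr_ge0 => j _; exact: sqr_ge0.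
set F := Num.sqrt (\sum_i f i ^+ 2); set G := Num.sqrt (\sum_i g i ^+ 2).
have [F0|F0] := eqVneq F 0.
  by rewrite F0 mul0r big1 // => i _; rewrite (zero f F0) mul0r.
have [G0|G0] := eqVneq G 0.
  by rewrite G0 mulr0 big1 // => i _; rewrite (zero g G0) mulr0.
have Fp : 0 < F by rewrite lt_neqAle eq_sym F0 sqrtr_ge0.
have Gp : 0 < G by rewrite lt_neqAle eq_sym G0 sqrtr_ge0.
(* The inequality of arithmetic and geometric means for f i / F and g i / G, multiplied by F G. *)
have FG i : f i * g i <= 2^-1 * (F * G) * (F ^- 2 * f i ^+ 2 + G ^- 2 * g i ^+ 2).
  rewrite -subr_ge0.
  have -> : 2^-1 * (F * G) * (F ^- 2 * f i ^+ 2 + G ^- 2 * g i ^+ 2) - f i * g i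
     = 2^-1 * (F * G) * (f i / F - g i / G) ^+ 2 by field; rewrite F0 G0.
  by rewrite mulr_ge0 ?sqr_ge0 // mulr_ge0 ?invr_ge0 // mulr_ge0 // ltW.
apply: le_trans (ler_sum _ (fun i _ => FG i)) _.
rewrite -mulr_sumr big_split -!mulr_sumr -(sqr_sqrtr (sq0 f)) -(sqr_sqrtr (sq0 g)).
rewrite -/F -/G le_eqVlt; apply/orP; left; apply/eqP.
by rewrite !mulVf ?sqrf_eq0 //=; field.
Qed.

Lemma sum_mulrb (R : realType) (d : nat) (a : R) (G : 'I_d -> R) (k : 'I_d) :
  \sum_l (a *+ (k == l)) * G l = a * G k.
Proof.
rewrite (bigD1 k) //= eqxx mulr1n big1 ?addr0 // => l lk.
by rewrite eq_sym (negbTE lk) mulr0n mul0r.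
Qed.

(** The displacement 0 is passed to [diagonal_coordinates] when only the coordinates at p matter. *)
Lemma hess_ge0 (R : realType) (n d : nat) (A : 'M[R]_(n, d)) (p y : 'cV[R]_n) :
  posdef (info A p) -> 0 <= hess A p y y.
Proof.
move=> pd; have [B [w [_ _ _ gp _]]] := diagonal_coordinates 0 pd.
rewrite (hess_coords _ _ gp); apply: sumr_ge0 => k _; apply: sumr_ge0 => l _.
by rewrite !mul1r -expr2 sqr_ge0.
Qed.

Lemma sqr_lnorm (R : realType) (n d : nat) (A : 'M[R]_(n, d)) (p y : 'cV[R]_n) :
  posdef (info A p) -> lnorm A p y ^+ 2 = hess A p y y.
Proof. by move=> pd; rewrite sqr_sqrtr ?hess_ge0. Qed.

(** In these coordinates the Hessian is the squared Frobenius norm of M(y), hence definite up to the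
    kernel of [info]. *)
Lemma hess_eq0 (R : realType) (n d : nat) (A : 'M[R]_(n, d)) (p y : 'cV[R]_n) :
  posdef (info A p) -> hess A p y y = 0 -> info A y = 0.
Proof.
move=> pd; have [B [w [_ _ B0 gp _]]] := diagonal_coordinates 0 pd.
rewrite (hess_coords _ _ gp) => /eqP h; apply: B0; apply/matrixP => k l.
have pos k' l' : 0 <= 1 * 1 * (info B y k' l' * info B y k' l').
  by rewrite !mul1r -expr2 sqr_ge0.
move: h; rewrite psumr_eq0 => [/allP /(_ k (mem_index_enum _))|i _]; last first.
  by apply: sumr_ge0 => j _.
rewrite /= psumr_eq0 => [/allP /(_ l (mem_index_enum _))|//].
by rewrite /= !mul1r -expr2 sqrf_eq0 => /eqP ->; rewrite mxE.
Qed.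

Lemma hess_le_lnorm (R : realType) (n d : nat) (A : 'M[R]_(n, d))
    (p y z : 'cV[R]_n) :
  posdef (info A p) -> hess A p y z <= lnorm A p y * lnorm A p z.
Proof.
move=> pd; have [B [w [_ _ _ gp _]]] := diagonal_coordinates 0 pd.
rewrite /lnorm !(hess_coords _ _ gp) !pair_bigA /=.
have := cauchy_schwarz_sum (fun i : 'I_d * 'I_d => info B y i.1 i.2)
  (fun i => info B z i.1 i.2).
rewrite (eq_bigr (fun i => 1 * 1 * (info B y i.1 i.2 * info B z i.1 i.2)));
  last by move=> i _; rewrite !mul1r.
move/le_trans; apply; rewrite le_eqVlt; apply/orP; left; apply/eqP.
by congr (Num.sqrt _ * Num.sqrt _); apply: eq_bigr => i _; rewrite !mul1r expr2.
Qed.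

(** M(p) becomes the identity, and pairing with it takes the trace. On the face this reads Hhat(p) p
    = v, from which the Newton system is solved. *)
Lemma hess_self (R : realType) (n d : nat) (A : 'M[R]_(n, d))
    (p y : 'cV[R]_n) :
  posdef (info A p) -> hess A p y p = dlogdet A p y.
Proof.
move=> pd; have [B [w [B1 _ _ gp _]]] := diagonal_coordinates 0 pd.
rewrite (hess_coords _ _ gp) (dlogdet_coords _ gp); apply: eq_bigr => k _.
rewrite -(sum_mulrb 1 (fun l => info B y k l)).
by apply: eq_bigr => l _; rewrite B1 mxE !mul1r mulrC.
Qed.

Lemma dlogdet_self (R : realType) (n d : nat) (A : 'M[R]_(n, d))
    (p : 'cV[R]_n) :
  posdef (info A p) -> dlogdet A p p = d%:R.
Proof.
move=> pd; have [B [w [B1 _ _ gp _]]] := diagonal_coordinates 0 pd.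
rewrite (dlogdet_coords _ gp) B1.
rewrite (eq_bigr (fun=> 1)) => [|k _]; last by rewrite mxE eqxx mul1r.
by rewrite sumr_const card_ord.
Qed.

(* The [w k] are the eigenvalues of M(x) relative to M(p). *)
Lemma relative_eigenvalues (R : realType) (n d : nat) (A : 'M[R]_(n, d))
    (p x : 'cV[R]_n) :
  posdef (info A p) -> exists (B : 'M[R]_(n, d)) (w : 'I_d -> R),
    [/\ forall i j, gram A p i j = \sum_k 1 * (B i k * B j k),
        dlogdet A p x = \sum_k w k,
        hess A p x x = \sum_k w k ^+ 2,
        forall y, hess A p y x = \sum_k w k * info B y k k &
        (posdef (info A (p + x)) <-> forall k, -1 < w k) /\
        ((forall k, -1 < w k) ->
           (forall i j,
              gram A (p + x) i j = \sum_k (1 + w k)^-1 * (B i k * B j k)) /\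
           fobj A (p + x) = fobj A p - \sum_k ln (1 + w k))].
Proof.
move=> pd; have [B [w [B1 Bw _ gp pq]]] := diagonal_coordinates x pd.
have hE y : hess A p y x = \sum_k w k * info B y k k.
  rewrite (hess_coords _ _ gp); apply: eq_bigr => k _.
  by rewrite -sum_mulrb; apply: eq_bigr => l _; rewrite Bw !mul1r mulrC.
exists B, w; split=> //.
  rewrite (dlogdet_coords _ gp); apply: eq_bigr => k _.
  by rewrite Bw eqxx mul1r.
by rewrite hE; apply: eq_bigr => k _; rewrite Bw eqxx.
Qed.

Lemma eigenvalue_bound (R : realType) (d : nat) (w : 'I_d -> R) (r : R) :
  Num.sqrt (\sum_k w k ^+ 2) <= r -> forall k, - r <= w k <= r.
Proof.
move=> wr k; rewrite -ler_norml -sqrtr_sqr; apply: le_trans wr.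
rewrite ler_wsqrtr // (bigD1 k) //= lerDl.
by apply: sumr_ge0 => i _; exact: sqr_ge0.
Qed.

(** * Self-concordance estimates between two points *)

Lemma fobj_lower (R : realType) (n d : nat) (A : 'M[R]_(n, d))
    (p x : 'cV[R]_n) :
  posdef (info A p) -> posdef (info A (p + x)) ->
  fobj A p - dlogdet A p x + zeta (lnorm A p x) <= fobj A (p + x).
Proof.
move=> pd pq; have [B [w [gp dE hE _ [pw h]]]] := relative_eigenvalues x pd.
have w1 := pw.1 pq; have [_ ->] := h w1.
have := sum_zeta_ge w1; rewrite -hE -/(lnorm _ _ _) dE.
rewrite sumrB; lra.
Qed.

(** The local norm bounds every |w k|, so a norm below 1 forces w k > -1: positive definiteness of
    M(p + x) comes as a conclusion. *)
Lemma fobj_upper (R : realType) (n d : nat) (A : 'M[R]_(n, d))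
    (p x : 'cV[R]_n) :
  posdef (info A p) -> lnorm A p x < 1 ->
  posdef (info A (p + x)) /\
  fobj A (p + x) <= fobj A p - dlogdet A p x + zeta (- lnorm A p x).
Proof.
move=> pd l1; have [B [w [gp dE hE _ [pw h]]]] := relative_eigenvalues x pd.
move: l1; rewrite /lnorm hE => l1.
have wr := eigenvalue_bound (lexx (Num.sqrt (\sum_k w k ^+ 2))).
have w1 k : -1 < w k by have /andP[] := wr k; lra.
split; first exact/pw.
have [_ ->] := h w1; have := sum_zeta_le l1; rewrite dE sumrB; lra.
Qed.

(* The Newton equation removes the first-order term, leaving
   [\sum_k w k ^+ 2 / (1 + w k) * Y k k]; the factor [Y k k / (1 + w k)] is
   controlled by the local norm at the new point. *)
Lemma newton_quadratic (R : realType) (n d : nat) (A : 'M[R]_(n, d))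
    (p x y : 'cV[R]_n) :
  posdef (info A p) -> lnorm A p x < 1 -> dlogdet A p y = hess A p y x ->
  dlogdet A (p + x) y <= lnorm A p x ^+ 2 * lnorm A (p + x) y.
Proof.
move=> pd l1 nE; have [pq _] := fobj_upper pd l1.
rewrite sqr_lnorm //.
have [B [w [gp dE hE hyE [pw h]]]] := relative_eigenvalues x pd.
have w1 := pw.1 pq; have [gq _] := h w1.
have w0 k : 1 + w k != 0 by rewrite gt_eqF //; have := w1 k; lra.
have -> : dlogdet A (p + x) y
    = \sum_k w k ^+ 2 * ((1 + w k)^-1 * info B y k k).
  (* The Newton equation in coordinates. Adding it works because 1 / (1 + w) + (w - 1) = w^2 / (1 +
     w). *)
  have e0 : \sum_k (w k - 1) * info B y k k = 0.
    move: nE; rewrite hyE (dlogdet_coords _ gp) => nE.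
    under eq_bigr => k _ do rewrite mulrBl.
    by rewrite sumrB -nE subrr.
  rewrite (dlogdet_coords _ gq) -[LHS]addr0 -[X in _ + X = _]e0 -big_split.
  by apply: eq_bigr => k _ /=; field.
apply: le_trans (cauchy_schwarz_sum _ _) _.
have s0 : 0 <= hess A p x x by rewrite hess_ge0.
apply: ler_pM; rewrite ?sqrtr_ge0 //.
  rewrite -[leRHS]ger0_norm // -sqrtr_sqr ler_wsqrtr //.
  rewrite hE expr2 mulr_suml; apply: ler_sum => k _.
  rewrite [leLHS]expr2 ler_wpM2l ?sqr_ge0 // (bigD1 k) //= lerDl.
  by apply: sumr_ge0 => j _; exact: sqr_ge0.
(* The Cauchy-Schwarz factor consists of the diagonal terms of the Hessian at p + x; the other terms
   are nonnegative. *)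
rewrite ler_wsqrtr // (hess_coords _ _ gq); apply: ler_sum => k _.
rewrite (bigD1 k) //= -[leLHS]addr0; apply: lerD.
  by rewrite le_eqVlt; apply/orP; left; apply/eqP; ring.
apply: sumr_ge0 => j _; rewrite -expr2 mulr_ge0 ?sqr_ge0 // mulr_ge0 //.
  by rewrite invr_ge0 ltW //; have := w1 k; lra.
by rewrite invr_ge0 ltW //; have := w1 j; lra.
Qed.

(** Every relative eigenvalue is at least - r, so passing from M(p)^-1 to M(p + x)^-1 costs at most
    a factor 1 / (1 - r). In [hess_le] the factor occurs twice. *)
Lemma leverage_le (R : realType) (n d : nat) (A : 'M[R]_(n, d))
    (p x : 'cV[R]_n) (r : R) i :
  posdef (info A p) -> lnorm A p x <= r -> r < 1 ->
  leverage A (p + x) i 0 <= (1 - r)^-1 * leverage A p i 0.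
Proof.
move=> pd lr r1.
have [B [w [gp dE hE _ [pw h]]]] := relative_eigenvalues x pd.
move: lr; rewrite /lnorm hE => /eigenvalue_bound wr.
have w1 k : -1 < w k by have /andP[] := wr k; lra.
have [gq _] := h w1; rewrite !leverageE gp gq mulr_sumr; apply: ler_sum => k _.
rewrite mul1r ler_wpM2r // -?expr2 ?sqr_ge0 // lef_pV2 ?posrE; first last.
- by lra.
- by have := w1 k; lra.
by have /andP[] := wr k; lra.
Qed.

Lemma hess_le (R : realType) (n d : nat) (A : 'M[R]_(n, d))
    (p x y : 'cV[R]_n) (r : R) :
  posdef (info A p) -> lnorm A p x <= r -> r < 1 ->
  hess A (p + x) y y <= (1 - r) ^- 2 * hess A p y y.
Proof.
move=> pd lr r1.
have [B [w [gp dE hE _ [pw h]]]] := relative_eigenvalues x pd.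
move: lr; rewrite /lnorm hE => /eigenvalue_bound wr.
have w1 k : -1 < w k by have /andP[] := wr k; lra.
have [gq _] := h w1; rewrite (hess_coords _ _ gq) (hess_coords _ _ gp).
rewrite mulr_sumr; apply: ler_sum => k _.
rewrite mulr_sumr; apply: ler_sum => l _.
have inv j : 0 <= (1 + w j)^-1 <= (1 - r)^-1.
  have := w1 j => w1j; rewrite invr_ge0 lef_pV2 ?posrE; [|lra..].
  by have /andP[] := wr j; lra.
have /andP[k0 k1] := inv k; have /andP[l0 l1] := inv l.
rewrite !mul1r ler_wpM2r -?expr2 ?sqr_ge0 // -exprVn expr2.
exact: ler_pM.
Qed.

(** * Restriction to a face *)

Lemma sum_extend (R : realType) (n : nat) (S : {set 'I_n}) (x : 'cV[R]_#|S|)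
    (F : 'I_n -> R) :
  \sum_i (extend x) i 0 * F i = \sum_k x k 0 * F (enum_val k).
Proof.
transitivity (\sum_i \sum_(k < #|S| | enum_val k == i) x k 0 * F (enum_val k)).
  apply: eq_bigr => i _; rewrite mxE mulr_suml.
  by apply: eq_bigr => k /eqP ->.
rewrite (exchange_big_dep predT) //=; apply: eq_bigr => k _.
by rewrite (big_pred1 (enum_val k)) // => i; rewrite eq_sym.
Qed.

Lemma sum_extend1 (R : realType) (n : nat) (S : {set 'I_n}) (x : 'cV[R]_#|S|) :
  \sum_i (extend x) i 0 = \sum_k x k 0.
Proof.
transitivity (\sum_i (extend x) i 0 * 1).
  by apply: eq_bigr => i _; rewrite mulr1.
by rewrite (sum_extend x (fun=> 1)); apply: eq_bigr => k _; rewrite mulr1.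
Qed.

Lemma extend_out (R : realType) (n : nat) (S : {set 'I_n}) (x : 'cV[R]_#|S|) i :
  i \notin S -> (extend x) i 0 = 0.
Proof.
move=> iS; rewrite mxE big1 // => k /eqP ki.
by move: iS; rewrite -ki enum_valP.
Qed.

Lemma extend_enum_val (R : realType) (n : nat) (S : {set 'I_n})
    (x : 'cV[R]_#|S|) k :
  (extend x) (enum_val k) 0 = x k 0.
Proof.
rewrite mxE (big_pred1 k) // => j.
by apply/eqP/eqP => [/enum_val_inj|->].
Qed.

Lemma supp_out (R : realType) (n : nat) (S : {set 'I_n}) (p : 'cV[R]_n) :
  supp p \subset S <-> forall i, i \notin S -> p i 0 = 0.
Proof.
split=> [/fintype.subsetP h i iS|h].
  by apply/eqP; apply: contraNT iS => pi; apply: h; rewrite inE.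
by apply/fintype.subsetP => i; rewrite inE; apply: contraNT => /h ->.
Qed.

Lemma extend_restrict (R : realType) (n : nat) (S : {set 'I_n}) (p : 'cV[R]_n) :
  supp p \subset S -> extend (restrict_to S p) = p.
Proof.
move=> /supp_out pS; apply/colP => i.
have [iS|iS] := boolP (i \in S); last by rewrite extend_out ?pS.
by rewrite -(enum_rankK_in iS iS) extend_enum_val mxE.
Qed.

Lemma HhatE (R : realType) (n d : nat) (A : 'M[R]_(n, d)) (S : {set 'I_n})
    (p : 'cV[R]_n) i j :
  Hhat A S p i j = gram A p (enum_val i) (enum_val j) ^+ 2.
Proof. by rewrite mxE gramE. Qed.

Lemma Hhat_sym (R : realType) (n d : nat) (A : 'M[R]_(n, d)) (S : {set 'I_n})
    (p : 'cV[R]_n) :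
  posdef (info A p) -> (Hhat A S p)^T = Hhat A S p.
Proof.
move=> pd; have [B [w [_ _ _ gp _]]] := diagonal_coordinates 0 pd.
apply/matrixP => i j; rewrite mxE !HhatE !gp; congr (_ ^+ 2).
by apply: eq_bigr => k _; ring.
Qed.

Lemma hess_extend (R : realType) (n d : nat) (A : 'M[R]_(n, d)) (S : {set 'I_n})
    (p : 'cV[R]_n) (y z : 'cV[R]_#|S|) :
  hess A p (extend y) (extend z) = bform (Hhat A S p) y z.
Proof.
rewrite /hess bformE.
transitivity (\sum_i (extend y) i 0 * \sum_j (extend z) j 0 * gram A p i j ^+ 2).
  by apply: eq_bigr => i _; rewrite mulr_sumr; apply: eq_bigr => j _; rewrite mulrA.
rewrite sum_extend; apply: eq_bigr => k _; rewrite sum_extend mulr_sumr.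
by apply: eq_bigr => l _; rewrite HhatE; ring.
Qed.

Lemma dlogdet_extend (R : realType) (n d : nat) (A : 'M[R]_(n, d))
    (S : {set 'I_n}) (p : 'cV[R]_n) (y : 'cV[R]_#|S|) :
  dlogdet A p (extend y) = \sum_k (restrict_to S (leverage A p)) k 0 * y k 0.
Proof.
rewrite /dlogdet sum_extend; apply: eq_bigr => k _.
by rewrite [in RHS]mxE mulrC.
Qed.

(** Linear independence of the a_i a_i^T with i in S, in the form that combines with [hess_eq0]. *)
Definition info_injective_on (R : realType) (n d : nat) (A : 'M[R]_(n, d))
    (S : {set 'I_n}) : Prop :=
  forall x : 'cV[R]_#|S|, info A (extend x) = 0 -> x = 0.

Lemma free_info_injective (R : realType) (n d : nat) (A : 'M[R]_(n, d))
    (S : {set 'I_n}) :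
  free [seq (row i A)^T *m row i A | i <- enum S] -> info_injective_on A S.
Proof.
move=> fr x x0; set g := fun i => (row i A)^T *m row i A.
have {}fr : free [tuple of map g (enum_tuple S)] by [].
move/freeP: fr => /(_ (fun k => x k 0)) h; apply/colP => k; rewrite mxE; apply: h.
rewrite -[RHS]x0; apply/matrixP => a b.
rewrite summxE infoE sum_extend; apply: eq_bigr => l _.
rewrite (nth_map (enum_val l)) -?enum_val_nth; last by rewrite -cardE.
by rewrite !mxE big_ord1 !mxE.
Qed.

Lemma Hhat_gt0 (R : realType) (n d : nat) (A : 'M[R]_(n, d)) (S : {set 'I_n})
    (p : 'cV[R]_n) (x : 'cV[R]_#|S|) :
  info_injective_on A S -> posdef (info A p) -> x != 0 ->
  0 < bform (Hhat A S p) x x.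
Proof.
move=> inj pd x0; rewrite -hess_extend lt_neqAle hess_ge0 // andbT eq_sym.
by apply: contra_neq x0 => /(hess_eq0 pd)/inj.
Qed.

Lemma card_le_pairs (d : nat) :
  #|[set x : 'I_d * 'I_d | (x.1 <= x.2)%N]%SET| = 'C(d.+1, 2).
Proof.
rewrite -bin2_sum big_nat_recl // add0n big_mkord -sum1_card.
transitivity (\sum_(j < d) \sum_(i < d | (i <= j)%N) 1)%N.
  rewrite (exchange_big_dep predT) // /= pair_big_dep /=.
  by apply: eq_bigl => x; rewrite inE.
apply: eq_bigr => j _; rewrite sum1_card.
transitivity #|'I_j.+1|; last by rewrite card_ord.
have inj : injective (widen_ord (ltn_ord j)).
  by move=> a b /(congr1 val) /= ab; exact: val_inj.
rewrite -(card_imset predT inj).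
apply: eq_card => i; rewrite [LHS]unfold_in /=; apply/idP/imsetP => [ij|[k _ ->]].
  by exists (Ordinal (ij : (i < j.+1)%N)) => //; apply/val_inj.
exact: ltn_ord k.
Qed.

(** A symmetric matrix is determined by its entries on and above the diagonal, so the rows of Z,
    which list these entries, are independent. *)
Lemma info_injective_card (R : realType) (n d : nat) (A : 'M[R]_(n, d))
    (S : {set 'I_n}) :
  info_injective_on A S -> (#|S| <= 'C(d.+1, 2))%N.
Proof.
move=> inj; rewrite -card_le_pairs; set U := finset _.
pose Z : 'M[R]_(#|S|, #|U|) := \matrix_(k, c)
  (A (enum_val k) (enum_val c).1 * A (enum_val k) (enum_val c).2).
suff : row_free Z by rewrite /row_free => /eqP <-; exact: rank_leq_col.
apply: inj_row_free => v vZ; suff vT0 : v^T = 0 by rewrite -[v]trmxK vT0 trmx0.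
apply: inj; apply/matrixP => a b.
wlog ab : a b / (a <= b)%N.
  move=> h; have [|/ltnW ba] := leqP a b; first exact: h.
  by rewrite -info_sym mxE h // !mxE.
have abU : (a, b) \in U by rewrite inE.
have := congr1 (fun z : 'rV[R]_#|U| => z 0 (enum_rank_in abU (a, b))) vZ.
rewrite infoE sum_extend !mxE => {2}<-; apply: eq_bigr => k _.
by rewrite !mxE enum_rankK_in.
Qed.

(** * Extreme eigenvalues on a subspace *)

(** The maximum of the Rayleigh quotient, found as a minimum for - H, is an eigenvalue and bounds
    all others, so the supremum is attained there. *)
Lemma lambda_maxP (R : realType) (m : nat) (H : 'M[R]_m) :
  (0 < m)%N -> H^T = H ->
  forall y, bform H y y <= lambda_max H * bform 1%:M y y.
Proof.
move=> m0 sH.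
have T0 (y : 'cV[R]_m) : \sum_k (fun=> 0) k * y k 0 = 0.
  by rewrite big1 // => k _; rewrite mul0r.
have sN : (- H)^T = - H by rewrite linearN /= sH.
have bN y z : bform (- H) y z = - bform H y z.
  by rewrite /bform mulmxN mulNmx [LHS]mxE.
have [|x [_ x1 xmin]] := @bform_min_on R m (fun=> 0) (- H).
  exists (delta_mx (Ordinal m0) 0); split; first exact: T0.
  apply/eqP => /matrixP /(_ (Ordinal m0) 0); rewrite !mxE !eqxx.
  by move/eqP; rewrite oner_eq0.
have xmax y : bform H y y <= bform H x x * bform 1%:M y y.
  by have := xmin y (T0 y); rewrite !bN mulNr lerN2.
suff -> : lambda_max H = bform H x x by [].
have ex : eigenvalue H (bform H x x).
  apply/eigenvalueP; exists x^T; last first.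
    apply/eqP => /(congr1 trmx); rewrite trmxK trmx0 => x0.
    by move/eqP: x1; rewrite x0 /bform mulmx0 mxE eq_sym oner_eq0.
  apply/rowP => i.
  have := bform_min_eigen sN (T0 _) x1 xmin (T0 (delta_mx i 0)).
  rewrite !bN mulNr => /oppr_inj; rewrite (bformC _ _ sH) (bformC _ x (trmx1 _ _)).
  have cE (z : 'rV[R]_m) : (z *m (delta_mx i 0 : 'cV[R]_m)) 0 0 = z 0 i.
    by rewrite -colE mxE.
  by rewrite {1 3}/bform mulmx1 !cE => ->; rewrite [RHS]mxE.
have ub : ubound [set a | eigenvalue H a] (bform H x x).
  move=> a /eigenvalueP [v va v0].
  have v0' : v^T != 0 by apply: contra_neq v0 => h; rewrite -[v]trmxK h trmx0.
  have := xmax v^T; rewrite {1}/bform trmxK va -scalemxAl mxE.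
  have -> : (v *m v^T) 0 0 = bform 1%:M v^T v^T by rewrite /bform mulmx1 trmxK.
  by rewrite ler_pM2r // bform1_gt0.
apply/eqP; rewrite eq_le; apply/andP; split.
  by apply: ge_sup => //; exists (bform H x x).
by apply: ub_le_sup => //; exists (bform H x x).
Qed.

(** The constrained minimum with [l] = 1; a nonzero tangent space makes the constraint set
    nonempty. *)
Lemma lambda_min_tangentP (R : realType) (m : nat) (H : 'M[R]_m) :
  H^T = H -> tangent R m <> [set 0] ->
  exists x, [/\ tangent R m x, bform 1%:M x x = 1,
    bform H x x = lambda_min_on (tangent R m) H &
    forall y, tangent R m y ->
      lambda_min_on (tangent R m) H * bform 1%:M y y <= bform H y y].
Proof.
move=> sH nT.
have TE (y : 'cV[R]_m) : (\sum_k (fun=> 1) k * y k 0 = 0) = tangent R m y.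
  by rewrite /tangent /=; congr (_ = _); apply: eq_bigr => k _; rewrite mul1r.
have [|x [Tx x1 xmin]] := @bform_min_on R m (fun=> 1) H.
  apply: contrapT => h; apply: nT; apply/seteqP; split => y /= Ty.
    by apply: contrapT => y0; apply: h; exists y; rewrite TE; split=> //; apply/eqP.
  by rewrite Ty; apply: big1 => k _; rewrite mxE.
have xT : tangent R m x by rewrite -TE.
suff <- : bform H x x = lambda_min_on (tangent R m) H.
  by exists x; split=> // y; rewrite -TE; exact: xmin.
have bE y z : (y^T *m (H *m z)) 0 0 = bform H y z by rewrite /bform mulmxA.
have b1 (y z : 'cV[R]_m) : (y^T *m z) 0 0 = bform 1%:M y z.
  by rewrite /bform mulmx1.
have ex : eigenvalue_on (tangent R m) H (bform H x x).
  exists x; split=> //.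
    apply/eqP => x0; move/eqP: x1.
    by rewrite x0 /bform mulmx0 mxE eq_sym oner_eq0.
  by move=> y Ty; rewrite bE b1 (bform_min_eigen sH Tx x1 xmin) // TE.
have lb : lbound [set a | eigenvalue_on (tangent R m) H a] (bform H x x).
  move=> a [z [Tz z0 za]]; have := xmin z; rewrite TE => /(_ Tz).
  by rewrite -(bE z z) za // b1 ler_pM2r // bform1_gt0.
apply/eqP; rewrite eq_le; apply/andP; split.
  by apply: lb_le_inf => //; exists (bform H x x).
by apply: ge_inf => //; exists (bform H x x).
Qed.

(** * The oracle computation of the Newton step *)

Lemma posdefZ (R : realType) (d : nat) (a : R) (M : 'M[R]_d) :
  0 < a -> posdef M -> posdef (a *: M).
Proof.
move=> a0 [sM pM]; split; first by rewrite linearZ /= sM.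
by move=> x x0; rewrite -scalemxAr -scalemxAl mxE mulr_gt0 // pM.
Qed.

Lemma posdef_unitmx (R : realType) (m : nat) (H : 'M[R]_m) :
  (forall x, x != 0 -> 0 < bform H x x) -> H \in unitmx.
Proof.
move=> pH; rewrite -row_free_unit; apply: inj_row_free => v vH.
apply: contrapT => /eqP v0.
have v0' : v^T != 0 by apply: contra_neq v0 => h; rewrite -[v]trmxK h trmx0.
by have := pH _ v0'; rewrite /bform trmxK vH mul0mx mxE ltxx.
Qed.

(** An explicit solution: H q = v for q the restriction of p, and H u = 1, so q - c u with
    multiplier c solves the equation for every c. The constraint fixes c because the entries of u
    sum to u^T H u > 0. *)
Lemma newton_system_solvable (R : realType) (n d : nat) (A : 'M[R]_(n, d))
    (S : {set 'I_n}) (p : 'cV[R]_n) :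
  info_injective_on A S -> posdef (info A p) -> supp p \subset S ->
  (0 < #|S|)%N ->
  exists x, newton_system (Hhat A S p) (restrict_to S (leverage A p)) x.
Proof.
move=> inj pd pS m0; set H := Hhat A S p.
have pH x : x != 0 -> 0 < bform H x x by apply: Hhat_gt0.
have uH := posdef_unitmx pH.
pose one : 'cV[R]_#|S| := const_mx 1.
pose u := invmx H *m one.
have Hu : H *m u = one by rewrite /u mulKVmx.
clearbody u.
have one0 : one != 0.
  apply/eqP => /matrixP /(_ (Ordinal m0) 0); rewrite !mxE => /eqP.
  by rewrite oner_eq0.
have u0 : u != 0 by apply: contra_neq one0 => h; rewrite -Hu h mulmx0.
have us : 0 < \sum_k u k 0.
  have := pH u u0; rewrite /bform -mulmxA Hu mxE.
  by under eq_bigr => k _ do rewrite !mxE mulr1.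
pose q := restrict_to S p.
have Hq : H *m q = restrict_to S (leverage A p).
  apply/colP => k; pose e : 'cV[R]_#|S| := delta_mx k 0.
  have : bform H e q = dlogdet A p (extend e).
    by rewrite -hess_extend extend_restrict // hess_self.
  rewrite dlogdet_extend /bform -mulmxA trmx_delta -rowE mxE => ->.
  rewrite (bigD1 k) //= big1 ?addr0 => [|j jk]; first by rewrite !mxE !eqxx mulr1.
  by rewrite [X in _ * X]mxE (negbTE jk) mulr0.
pose c := (\sum_k q k 0) / \sum_k u k 0.
exists (q - c *: u, c); split => /=.
  by rewrite mulmxBr Hq -scalemxAr Hu subrK.
transitivity (\sum_k q k 0 - c * \sum_k u k 0).
  by rewrite mulr_sumr -sumrB; apply: eq_bigr => k _; rewrite !mxE.
by rewrite /c divfK ?subrr // gt_eqF.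
Qed.

(** The multiplier term is constant on S and vanishes against tangent vectors. Later proofs use only
    this weak form, so any solution selected by [cid] will do. *)
Lemma newton_system_direction (R : realType) (n d : nat) (A : 'M[R]_(n, d))
    (S : {set 'I_n}) (p : 'cV[R]_n) x :
  newton_system (Hhat A S p) (restrict_to S (leverage A p)) x ->
  forall y, tangent R #|S| y ->
    dlogdet A p (extend y) = hess A p (extend y) (extend x.1).
Proof.
move=> [hx _] y Ty; rewrite hess_extend dlogdet_extend -hx /bform -mulmxA.
set v := _ *m x.1; clearbody v.
transitivity (\sum_k v k 0 * y k 0 + x.2 * \sum_k y k 0).
  rewrite mulr_sumr -big_split; apply: eq_bigr => k _.
  by rewrite !mxE mulr1 mulrDl.
rewrite Ty mulr0 addr0 mxE; apply: eq_bigr => k _.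
by rewrite mxE mulrC.
Qed.

(* In diagonal coordinates of M(p) and a_j a_j^T, the latter being of rank one,
   at most one eigenvalue [w k = b k ^+ 2] is nonzero. *)
Lemma leverage_rank_one_update (R : realType) (n d : nat) (A : 'M[R]_(n, d))
    (p : 'cV[R]_n) (j : 'I_n) :
  posdef (info A p) ->
  posdef (info A (p + delta_mx j 0)) /\
  forall i, (leverage A p i 0 - leverage A (p + delta_mx j 0) i 0)
            * (1 + leverage A p j 0) = gram A p i j ^+ 2.
Proof.
move=> pd; have [B [w [_ Bw _ gp [pq h]]]] := diagonal_coordinates (delta_mx j 0) pd.
have info_delta k l : info B (delta_mx j 0) k l = B j k * B j l.
  rewrite infoE (bigD1 j) //= big1 ?addr0 => [|i ij].
    by rewrite mxE !eqxx mul1r.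
  by rewrite mxE (negbTE ij) mul0r.
have wE k : w k = B j k ^+ 2 by have := Bw k k; rewrite info_delta eqxx mulr1n.
have orth k l : k != l -> B j k * B j l = 0.
  by move=> kl; rewrite -info_delta Bw (negbTE kl).
have w0 k : 0 <= w k by rewrite wE sqr_ge0.
have w1 k : -1 < w k by have := w0 k; lra.
split; first exact/pq.
have [gq _] := h w1; move=> i; rewrite !leverageE !gp gq -sumrB.
(* Both sides equal this sum: 1 - 1 / (1 + w k) = w k / (1 + w k), and by [orth] the factor 1 + v_j
   reduces to 1 + w k wherever w k is nonzero. *)
transitivity (\sum_k w k * B i k ^+ 2).
  rewrite mulr_suml; apply: eq_bigr => k _.
  have wk : w k * (1 + \sum_l 1 * (B j l * B j l)) = w k * (1 + w k).
    rewrite (bigD1 k) //= !mulrDr addrA mul1r -expr2 -wE.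
    rewrite mulr_sumr big1 ?addr0 // => l lk.
    by rewrite wE mul1r expr2 mulrACA orth ?mul0r // eq_sym.
  have k0 : 1 + w k != 0 by rewrite gt_eqF //; have := w1 k; lra.
  transitivity (w k * (1 + \sum_l 1 * (B j l * B j l)) * ((1 + w k)^-1 * B i k ^+ 2)).
    by field.
  by rewrite wk; field.
rewrite expr2 mulr_suml; apply: eq_bigr => k _.
rewrite (bigD1 k) //= mulrDr mulr_sumr big1 ?addr0 => [|l lk]; first by rewrite wE; ring.
transitivity (B i k * B i l * (B j k * B j l)); first by ring.
by rewrite orth ?mulr0 // eq_sym.
Qed.

Lemma leverageZ (R : realType) (n d : nat) (A : 'M[R]_(n, d)) (a : R)
    (p : 'cV[R]_n) i :
  0 < a -> posdef (info A p) ->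
  leverage A (a *: p) i 0 = a^-1 * leverage A p i 0.
Proof.
move=> a0 pd; rewrite !leverageE /gram infoZ invmxZ.
  by rewrite -scalemxAr -scalemxAl mxE.
by apply: posdef_unitmx => x x0; case: (posdefZ a0 pd) => _; apply.
Qed.

(** Halving p + e_j, which makes it a design when p is one, doubles the leverage scores; the factor
    1/2 in [queried_hessian] undoes this. *)
Lemma queried_hessianE (R : realType) (n d : nat) (A : 'M[R]_(n, d))
    (S : {set 'I_n}) (p : 'cV[R]_n) (o : 'cV[R]_n -> 'cV[R]_n) :
  leverage_oracle A o -> posdef (info A p) ->
  queried_hessian S (leverage A p)
    (map o [seq midpoint p (enum_val j) | j <- enum 'I_#|S|]) = Hhat A S p.
Proof.
move=> ho pd; apply/matrixP => i j; rewrite HhatE mxE -map_comp.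
rewrite (nth_map j) ?size_enum_ord // nth_ord_enum /=.
have [pq hq] := leverage_rank_one_update (enum_val j) pd.
have a0 : 0 < 2^-1 :> R by [].
rewrite ho; last by rewrite /midpoint infoZ; exact: posdefZ.
rewrite -hq (leverageZ _ a0 pq) mulrA mulfV ?mul1r //.
Qed.

Lemma exec_ask_seq (Q B X : Type) (o : Q -> B) (qs : seq Q)
    (k : seq B -> prog Q B X) :
  exec o (ask_seq qs k) =
  (qs ++ (exec o (k (map o qs))).1, (exec o (k (map o qs))).2).
Proof.
elim: qs k => [|q qs IH] k /=; first by rewrite -surjective_pairing.
by rewrite IH.
Qed.

Lemma exec_facial_newton (R : realType) (n d : nat) (A : 'M[R]_(n, d))
    (S : {set 'I_n}) (eps : R) (p : 'cV[R]_n) (o : 'cV[R]_n -> 'cV[R]_n) :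
  leverage_oracle A o -> info_injective_on A S -> posdef (info A p) ->
  supp p \subset S -> (0 < #|S|)%N ->
  if vmax (leverage A p) - d%:R <= eps * d%:R then
    exec o (facial_newton_iter d S eps p) = ([:: p], Returned p)
  else exists x : 'cV[R]_#|S|,
    [/\ tangent R #|S| x,
        forall y, tangent R #|S| y ->
          dlogdet A p (extend y) = hess A p (extend y) (extend x) &
        exec o (facial_newton_iter d S eps p) =
          (p :: [seq midpoint p (enum_val j) | j <- enum 'I_#|S|],
           let lam := lnorm A p (extend x) in
           if 4^-1 < lam then DampedStep (p + (1 + lam)^-1 *: extend x)
           else FullStep (p + extend x))].
Proof.
move=> ho inj pd pS m0; rewrite /facial_newton_iter /= ho //.
case: (_ <= _) => /=; first by [].
rewrite exec_ask_seq queried_hessianE //.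
case: pselect => [ex|]; last by case; exact: newton_system_solvable.
have hx := projT2 (cid ex); have dx := newton_system_direction hx.
have Tx : tangent R #|S| (projT1 (cid ex)).1 by case: hx.
exists (projT1 (cid ex)).1; split=> //=.
(* The Newton equation tested against x itself identifies the computed lambda with the local norm of
   x. *)
by rewrite cats0 /lnorm -dx // dlogdet_extend.
Qed.

(** * The sublevel set *)

Lemma tangent_card_gt0 (R : realType) (m : nat) :
  tangent R m <> [set 0] -> (0 < m)%N.
Proof.
case: m => // nT; exfalso; apply: nT; apply/seteqP; split => x /= _.
  by apply/matrixP => -[].
exact: big_ord0.
Qed.

Lemma info_injective_dim_gt0 (R : realType) (n d : nat) (A : 'M[R]_(n, d))
    (S : {set 'I_n}) :
  info_injective_on A S -> (0 < #|S|)%N -> (0 < d)%N.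
Proof.
case: d A => // A inj m0.
have /matrixP /(_ (Ordinal m0) 0) : const_mx 1 = 0 :> 'cV[R]_#|S|.
  by apply: inj; apply/matrixP => -[].
by rewrite !mxE => /eqP; rewrite oner_eq0.
Qed.

Lemma spectral_bounds (R : realType) (n d : nat) (A : 'M[R]_(n, d))
    (pstar : 'cV[R]_n) :
  nondegenerate_design A pstar -> tangent R #|contact A pstar| <> [set 0] ->
  [/\ 0 < mu_star A pstar, mu_star A pstar <= L_star A pstar &
      1 <= kappa A pstar].
Proof.
move=> [[_ pd _] _ _ /free_info_injective inj] nT.
have m0 := tangent_card_gt0 nT.
have sH := Hhat_sym (contact A pstar) pd.
have [x [_ x1 hx _]] := lambda_min_tangentP sH nT.
have x0 : x != 0.
  by apply/eqP => x0; move/eqP: x1; rewrite x0 /bform mulmx0 mxE eq_sym oner_eq0.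
have mu0 : 0 < mu_star A pstar by rewrite /mu_star -hx Hhat_gt0.
have muL : mu_star A pstar <= L_star A pstar.
  by have := lambda_maxP m0 sH x; rewrite hx x1 mulr1.
by split=> //; rewrite /kappa ler_pdivlMr // mul1r.
Qed.

Lemma design_gt0 (R : realType) (n d : nat) (A : 'M[R]_(n, d))
    (pstar : 'cV[R]_n) i :
  nondegenerate_design A pstar -> i \in contact A pstar -> 0 < pstar i 0.
Proof.
move=> [[[p0 _] _ _] <- _ _]; rewrite inE => pi.
by rewrite lt_neqAle eq_sym pi p0.
Qed.

Lemma pmin_gt0 (R : realType) (n d : nat) (A : 'M[R]_(n, d))
    (pstar : 'cV[R]_n) :
  nondegenerate_design A pstar -> 0 < pmin A pstar.
Proof.
move=> nd; apply: lt_bigmin => // i iS; exact: design_gt0 nd iS.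
Qed.

(** The extended minimum lies in (0, 1/2], so [fine] preserves it. The bound 1/2 controls c0 and the
    change of Hessian, the next one keeps the weights on the contact set positive, and the last one
    leaves room for the leverages off it. *)
Lemma rbarE (R : realType) (n d : nat) (A : 'M[R]_(n, d)) (pstar : 'cV[R]_n) :
  nondegenerate_design A pstar -> tangent R #|contact A pstar| <> [set 0] ->
  [/\ 0 < rbar A pstar, rbar A pstar <= 2^-1,
      rbar A pstar <= pmin A pstar * Num.sqrt (mu_star A pstar) / 2 &
      forall i, i \notin contact A pstar ->
        leverage A pstar i 0 <= d%:R - 2 * d%:R * rbar A pstar].
Proof.
move=> nd nT; have [mu0 _ _] := spectral_bounds nd nT.
have p0 := pmin_gt0 nd.
case: nd => [_ _ gam0 /free_info_injective inj].
have d0 : 0 < d%:R :> R.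
  by rewrite ltr0n; exact: info_injective_dim_gt0 inj (tangent_card_gt0 nT).
have c0 : 0 < (2 * d%:R)^-1 :> R by rewrite invr_gt0 mulr_gt0.
rewrite /rbar; set g := (gamma_sc A pstar * _)%E.
set b := pmin A pstar * _ / 2.
have b0 : 0 < b by rewrite divr_gt0 // mulr_gt0 // sqrtr_gt0.
have g0 : (0 < g)%E by rewrite mule_gt0 // lte_fin.
set e := Order.min _ _.
have e0 : (0 < e)%E by rewrite /e !lt_min g0 !lte_fin b0 invr_gt0 ltr0n.
have eh : (e <= (2^-1)%:E)%E by rewrite /e ge_min lexx.
have eb : (e <= b%:E)%E by rewrite /e !ge_min lexx !orbT.
have eg : (e <= g)%E by rewrite /e !ge_min lexx !orbT.
have ef : e = (fine e)%:E.
  rewrite fineK // fin_numE; apply/andP; split.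
    by apply/eqP => h; move: e0; rewrite h.
  by apply/eqP => h; move: eh; rewrite h.
split.
- by rewrite -lte_fin -ef.
- by rewrite -lee_fin -ef.
- by rewrite -lee_fin -ef.
move=> i iS; have gi : (gamma_sc A pstar <= (d%:R - leverage A pstar i 0)%:E)%E.
  exact: bigmin_le_cond.
have : (e <= ((d%:R - leverage A pstar i 0) * (2 * d%:R)^-1)%:E)%E.
  apply: le_trans eg _; rewrite EFinM; exact: lee_wpmul2r.
rewrite ef lee_fin ler_pdivlMr ?mulr_gt0 // => h; lra.
Qed.

Lemma dlogdet_contact (R : realType) (n d : nat) (A : 'M[R]_(n, d))
    (pstar x : 'cV[R]_n) :
  supp x \subset contact A pstar ->
  dlogdet A pstar x = d%:R * \sum_i x i 0.
Proof.
move=> /supp_out xS; rewrite mulr_sumr; apply: eq_bigr => i _.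
have [|/xS ->] := boolP (i \in contact A pstar); last by rewrite mul0r mulr0.
by rewrite inE => /eqP ->; rewrite mulrC.
Qed.

Lemma face_domain_design (R : realType) (n d : nat) (A : 'M[R]_(n, d))
    (pstar : 'cV[R]_n) :
  nondegenerate_design A pstar -> face_domain A (contact A pstar) pstar.
Proof.
by move=> [[[_ p1] pd _] ps _ _]; split=> //; rewrite ps.
Qed.

Lemma supp_sub (R : realType) (n : nat) (S : {set 'I_n}) (p q : 'cV[R]_n) :
  supp p \subset S -> supp q \subset S -> supp (p - q) \subset S.
Proof.
move=> /supp_out pS /supp_out qS; apply/supp_out => i iS.
by rewrite !mxE pS ?qS // subrr.
Qed.

Lemma sum_sub (R : realType) (n : nat) (p q : 'cV[R]_n) :
  \sum_i (p - q) i 0 = \sum_i p i 0 - \sum_i q i 0.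
Proof. by rewrite -sumrB; apply: eq_bigr => i _; rewrite !mxE. Qed.

Lemma face_domain_lower (R : realType) (n d : nat) (A : 'M[R]_(n, d))
    (pstar p : 'cV[R]_n) :
  nondegenerate_design A pstar -> face_domain A (contact A pstar) p ->
  fobj A pstar + zeta (lnorm A pstar (p - pstar)) <= fobj A p.
Proof.
move=> nd [pS p1 pd]; have [qS q1 qd] := face_domain_design nd.
have := fobj_lower (x := p - pstar) qd.
rewrite subrKC dlogdet_contact ?supp_sub // sum_sub p1 q1 subrr mulr0 subr0.
exact.
Qed.

(** Optimality of [pstar] compares it with designs only, whereas [face_domain] admits signed
    weights; the lower bound covers these too. *)
Lemma face_domain_min (R : realType) (n d : nat) (A : 'M[R]_(n, d))
    (pstar p : 'cV[R]_n) :
  nondegenerate_design A pstar -> face_domain A (contact A pstar) p ->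
  fobj A pstar <= fobj A p.
Proof.
move=> nd /(face_domain_lower nd); apply: le_trans.
by rewrite lerDl zeta_ge0 ?sqrtr_ge0.
Qed.

Lemma sublevel_lnorm (R : realType) (n d : nat) (A : 'M[R]_(n, d))
    (pstar p : 'cV[R]_n) :
  nondegenerate_design A pstar -> tangent R #|contact A pstar| <> [set 0] ->
  sublevel A pstar p -> lnorm A pstar (p - pstar) <= rbar A pstar.
Proof.
move=> nd nT [pD pf]; have [r0 _ _ _] := rbarE nd nT.
rewrite leNgt; apply/negP => /(zeta_lt (ltW r0)).
by have := face_domain_lower nd pD; move: pf; rewrite /c0; lra.
Qed.

(** With x = p - [pstar], mu |x|^2 is at most the squared local norm, hence at most (pmin sqrt mu /
    2)^2. So each weight moves by at most pmin / 2. *)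
Lemma sublevel_gt0 (R : realType) (n d : nat) (A : 'M[R]_(n, d))
    (pstar p : 'cV[R]_n) i :
  nondegenerate_design A pstar -> tangent R #|contact A pstar| <> [set 0] ->
  sublevel A pstar p -> i \in contact A pstar -> 0 < p i 0.
Proof.
move=> nd nT ps iS; have lr := sublevel_lnorm nd nT ps.
case: ps => [[pS p1 _] _].
have [qS q1 qd] := face_domain_design nd.
have [r0 _ rp _] := rbarE nd nT; have [mu0 _ _] := spectral_bounds nd nT.
set S := contact A pstar in iS pS qS *; set x := p - pstar.
have xS : supp x \subset S by exact: supp_sub.
have x0 : \sum_i x i 0 = 0 by rewrite sum_sub p1 q1 subrr.
set y := restrict_to S x.
have xE : extend y = x by exact: extend_restrict.
have Ty : tangent R #|S| y.
  by rewrite /tangent /= -[RHS]x0 -xE sum_extend1.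
have [_ [_ _ _ /(_ y Ty)]] := lambda_min_tangentP (Hhat_sym S qd) nT.
rewrite -hess_extend xE -/(mu_star _ _) -sqr_lnorm // => hy.
have pmi : pmin A pstar <= pstar i 0 by exact: bigmin_le_cond.
have pm0 := pmin_gt0 nd.
set s := Num.sqrt (mu_star A pstar) in rp.
have s0 : 0 < s by rewrite sqrtr_gt0.
have s2 : s ^+ 2 = mu_star A pstar by rewrite sqr_sqrtr // ltW.
have yi : x i 0 ^+ 2 <= bform 1%:M y y.
  rewrite bform1E -xE -(enum_rankK_in iS iS) extend_enum_val.
  rewrite (bigD1 (enum_rank_in iS i)) //= -expr2 lerDl.
  by apply: sumr_ge0 => k _; rewrite -expr2 sqr_ge0.
have l0 : 0 <= lnorm A pstar x by exact: sqrtr_ge0.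
have sx : (s * `|x i 0|) ^+ 2 <= (pmin A pstar * s / 2) ^+ 2.
  rewrite exprMn s2 real_normK ?num_real //.
  apply: (@le_trans _ _ (lnorm A pstar x ^+ 2)).
    by apply: le_trans hy; rewrite ler_wpM2l // ltW.
  by rewrite ler_sqr ?nnegrE ?(le_trans lr) //; nra.
have : `|x i 0| <= pmin A pstar / 2.
  rewrite -(ler_pM2l s0) -ler_sqr ?nnegrE ?mulr_ge0 ?(ltW s0) //; last first.
    by rewrite ltW.
  by apply: le_trans sx _; rewrite le_eqVlt; apply/orP; left; apply/eqP; ring.
by rewrite ler_norml !mxE => /andP[]; lra.
Qed.

Lemma sublevel_face (R : realType) (n d : nat) (A : 'M[R]_(n, d))
    (pstar p : 'cV[R]_n) :
  nondegenerate_design A pstar -> tangent R #|contact A pstar| <> [set 0] ->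
  sublevel A pstar p -> face R (contact A pstar) p.
Proof.
move=> nd nT ps; have pos := @sublevel_gt0 _ _ _ A pstar p _ nd nT ps.
case: ps => [[pS p1 _] _]; split=> //; split=> // i.
have [/pos/ltW //|iS] := boolP (i \in contact A pstar).
by move/supp_out: pS => ->.
Qed.

(* Every affine combination of points of the face keeps support in S and total
   mass 1, so only the positivity of the weights on S is at stake. *)
Lemma relint_face_gt0 (R : realType) (n : nat) (S : {set 'I_n}) (p : 'cV[R]_n) :
  face R S p -> (forall i, i \in S -> 0 < p i 0) -> relint (face R S) p.
Proof.
move=> fp pos; split=> //.
have pnear : \forall y \near (p : 'cV[R]_n), forall i, i \in S -> 0 < (y : 'cV[R]_n) i 0.
  have FF : Filter (nbhs p) by exact: nbhs_filter.
  apply: (@filter_forall _ _ (fun i (y : 'cV[R]_n) => i \in S -> 0 < y i 0) _ FF) => i.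
  have [iS|iS] := boolP (i \in S); last by apply: nearW.
  near=> y => _; near: y.
  have : (fun y : 'cV[R]_n => y i 0) @ p --> p i 0 by exact: coord_continuous.
  by move/cvgr_gt; apply; exact: pos.
rewrite /within /=; near=> y => -[k [c [x [xf c1 yE]]]].
have ypos : forall i, i \in S -> 0 < y i 0 by near: y.
have yi i : y i 0 = \sum_j c j * x j i 0.
  by rewrite yE summxE; apply: eq_bigr => j _; rewrite mxE.
have yout i : i \notin S -> y i 0 = 0.
  move=> iS; rewrite yi big1 // => j _; have [_ /supp_out ->//] := xf j.
  by rewrite mulr0.
split; last exact/supp_out.
split=> [i|]; first by have [/ypos/ltW//|/yout ->] := boolP (i \in S).
under eq_bigr => i _ do rewrite yi.
rewrite exchange_big /= -[RHS]c1; apply: eq_bigr => j _.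
by have [[_ xj] _] := xf j; rewrite -mulr_sumr xj mulr1.
Unshelve. all: by end_near.
Qed.

(** The segment from q to p can be prolonged slightly beyond p inside the face; at the new point (1
    + t) p_i - t q_i >= 0. *)
Lemma face_relint_gt0 (R : realType) (n : nat) (S : {set 'I_n})
    (p q : 'cV[R]_n) i :
  relint (face R S) p -> face R S q -> 0 < q i 0 -> 0 < p i 0.
Proof.
move=> [fp pn] fq qi.
have cF : (fun t : R => p + t *: (p - q)) @ (0 : R) --> p.
  rewrite -[X in _ --> X]addr0 -(scale0r (p - q)).
  by apply: cvgD; [exact: cvg_cst|apply: cvgZr_tmp; exact: cvg_id].
have := cF _ pn; rewrite /within /= => /nbhs_ballP [e e0 he].
pose t : R := e / 2.
have t0 : 0 < t by rewrite divr_gt0.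
have tb : ball (0 : R) e t.
  rewrite /ball /= sub0r normrN gtr0_norm // /t.
  by move: e0 => /= e0; lra.
have [[h _] _] : face R S (p + t *: (p - q)).
  apply: he => //.
  exists 2%N, (fun j => if j == 0 then 1 + t else - t),
    (fun j => if j == 0 then p else q).
  split.
  - by move=> j; case: ifP.
  - by rewrite big_ord_recl big_ord1 /=; lra.
  - rewrite big_ord_recl big_ord1 /= scalerBr scalerDl scale1r scaleNr addrA.
    by [].
have := h i; rewrite !mxE => hi; nra.
Qed.

(** The quadratic form is the sum of p_i (a_i^T x)^2; where it vanishes for p, every term with q_i
    nonzero vanishes, and so does the form of q. *)
Lemma face_posdef (R : realType) (n d : nat) (A : 'M[R]_(n, d)) (p q : 'cV[R]_n) :
  posdef (info A q) -> (forall i, 0 <= p i 0) ->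
  (forall i, q i 0 != 0 -> 0 < p i 0) -> posdef (info A p).
Proof.
move=> [_ qd] p0 pq; split; first exact: info_sym.
move=> x x0.
have iE (r : 'cV[R]_n) :
    (x^T *m info A r *m x) 0 0 = \sum_i r i 0 * (row i A *m x) 0 0 ^+ 2.
  rewrite /info mulmx_sumr mulmx_suml summxE; apply: eq_bigr => i _.
  rewrite -scalemxAr -scalemxAl mxE; congr (_ * _).
  have -> : x^T *m ((row i A)^T *m row i A) *m x = (row i A *m x)^T *m (row i A *m x).
    by rewrite trmx_mul !mulmxA.
  by rewrite mxE big_ord1 expr2 [X in X * _]mxE.
have ge0 i : 0 <= p i 0 * (row i A *m x) 0 0 ^+ 2.
  by rewrite mulr_ge0 ?sqr_ge0.
rewrite iE lt_neqAle sumr_ge0 // andbT eq_sym; apply/eqP => /eqP.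
rewrite psumr_eq0 // => /allP s0.
have := qd x x0; rewrite iE big1 ?ltxx // => i _.
have := s0 i (mem_index_enum _); rewrite /= mulf_eq0.
have [->|/pq/gt_eqF ->] := eqVneq (q i 0) 0; first by rewrite mul0r.
by rewrite /= => /eqP ->; rewrite mulr0.
Qed.

(** Membership in [face_domain] requires M(p) to be positive definite; this is inherited from
    [pstar], as p is positive wherever [pstar] is. *)
Lemma relint_sublevel (R : realType) (n d : nat) (A : 'M[R]_(n, d))
    (pstar p : 'cV[R]_n) :
  nondegenerate_design A pstar -> relint (face R (contact A pstar)) p ->
  fobj A p - fobj A pstar <= c0 A pstar -> sublevel A pstar p.
Proof.
move=> nd rp fp; have [[[p0 p1] pS] _] := rp.
have [qS q1 qd] := face_domain_design nd.
have qf : face R (contact A pstar) pstar by split=> //; case: nd => -[].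
split; last by rewrite -lerBlDl.
split=> //; apply: (face_posdef qd) => // i qi.
apply: face_relint_gt0 rp qf _.
by apply: (design_gt0 nd); case: nd => _ <- _ _; rewrite inE.
Qed.

Lemma sublevel_relint (R : realType) (n d : nat) (A : 'M[R]_(n, d))
    (pstar : 'cV[R]_n) :
  nondegenerate_design A pstar -> tangent R #|contact A pstar| <> [set 0] ->
  sublevel A pstar `<=` relint (face R (contact A pstar)).
Proof.
move=> nd nT p ps; apply: relint_face_gt0 => [|i]; first exact: sublevel_face nd nT ps.
exact: sublevel_gt0.
Qed.

(** * Newton steps *)

(** An upper bound on the Newton decrement, which is the least such l >= 0. *)
Definition decrement_le (R : realType) (n d : nat) (A : 'M[R]_(n, d))
    (S : {set 'I_n}) (p : 'cV[R]_n) (l : R) : Prop :=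
  forall y : 'cV[R]_#|S|, tangent R #|S| y ->
    dlogdet A p (extend y) <= l * lnorm A p (extend y).

Lemma dlogdetZ (R : realType) (n d : nat) (A : 'M[R]_(n, d)) (p x : 'cV[R]_n)
    (c : R) :
  dlogdet A p (c *: x) = c * dlogdet A p x.
Proof.
by rewrite /dlogdet mulr_sumr; apply: eq_bigr => i _; rewrite mxE mulrA.
Qed.

Lemma lnormZ (R : realType) (n d : nat) (A : 'M[R]_(n, d)) (p x : 'cV[R]_n)
    (c : R) :
  0 <= c -> lnorm A p (c *: x) = c * lnorm A p x.
Proof.
move=> c0; rewrite /lnorm.
have -> : hess A p (c *: x) (c *: x) = c ^+ 2 * hess A p x x.
  rewrite /hess mulr_sumr; apply: eq_bigr => i _; rewrite mulr_sumr.
  by apply: eq_bigr => j _; rewrite 2![(c *: x) _ _]mxE; ring.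
by rewrite sqrtrM ?sqr_ge0 // sqrtr_sqr ger0_norm.
Qed.

(** The step length 1 / (1 + l) minimizes over s the upper bound - s l^2 + zeta (- s l), and the
    minimum is - zeta l. *)
Lemma damped_step (R : realType) (n d : nat) (A : 'M[R]_(n, d)) (p x : 'cV[R]_n) :
  posdef (info A p) -> dlogdet A p x = hess A p x x ->
  let l := lnorm A p x in let p' := p + (1 + l)^-1 *: x in
  posdef (info A p') /\ fobj A p' <= fobj A p - zeta l.
Proof.
move=> pd nE l p'; have l0 : 0 <= l by exact: sqrtr_ge0.
have c0 : 0 < (1 + l)^-1 by rewrite invr_gt0; lra.
have lE : lnorm A p ((1 + l)^-1 *: x) = l / (1 + l).
  by rewrite lnormZ ?(ltW c0) // mulrC.
have [|pd' fp] := fobj_upper (x := (1 + l)^-1 *: x) pd.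
  by rewrite lE ltr_pdivrMr; lra.
split=> //; apply: le_trans fp _.
rewrite lE dlogdetZ nE -sqr_lnorm // -/l /zeta.
have -> : 1 + - (l / (1 + l)) = (1 + l)^-1 by field; rewrite gt_eqF //; lra.
rewrite lnV ?posrE; last by lra.
have -> : (1 + l)^-1 * l ^+ 2 = l - l / (1 + l) by field; rewrite gt_eqF //; lra.
lra.
Qed.

(** The upper bound changes f by zeta (- l) - l^2, which [zeta_opp_le] makes nonpositive; full steps
    therefore stay in the sublevel set. *)
Lemma full_step (R : realType) (n d : nat) (A : 'M[R]_(n, d)) (p x : 'cV[R]_n) :
  posdef (info A p) -> dlogdet A p x = hess A p x x -> lnorm A p x <= 4^-1 ->
  posdef (info A (p + x)) /\ fobj A (p + x) <= fobj A p.
Proof.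
move=> pd nE l4; have l0 : 0 <= lnorm A p x by exact: sqrtr_ge0.
have [|pd' fp] := fobj_upper (x := x) pd; first by lra.
split=> //; apply: le_trans fp _; rewrite nE -sqr_lnorm //.
have := @zeta_opp_le R (lnorm A p x); rewrite l0 l4 => /(_ isT); lra.
Qed.

Lemma sublevel_step (R : realType) (n d : nat) (A : 'M[R]_(n, d))
    (pstar p : 'cV[R]_n) (x : 'cV[R]_#|contact A pstar|) (c : R) :
  let p' := p + c *: extend x in
  sublevel A pstar p -> tangent R #|contact A pstar| x ->
  posdef (info A p') -> fobj A p' <= fobj A p -> sublevel A pstar p'.
Proof.
move=> p' [[/supp_out pS p1 pd] pf] Tx pd' fp; split; last exact: le_trans pf.
split=> //.
  by apply/supp_out => i iS; rewrite [LHS]mxE pS // mxE extend_out // mulr0 addr0.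
have -> : \sum_i p' i 0 = \sum_i p i 0 + c * \sum_i (extend x) i 0.
  rewrite mulr_sumr -big_split; apply: eq_bigr => i _.
  by rewrite [LHS]mxE [X in _ + X]mxE.
by rewrite sum_extend1 Tx mulr0 addr0.
Qed.

Lemma tau_gt0 (R : realType) (n d : nat) (A : 'M[R]_(n, d)) (pstar : 'cV[R]_n)
    (eps : R) :
  nondegenerate_design A pstar -> tangent R #|contact A pstar| <> [set 0] ->
  0 < eps -> 0 < tau A pstar eps.
Proof.
move=> nd nT e0; have [mu0 muL k1] := spectral_bounds nd nT.
have d0 : 0 < d%:R :> R.
  case: nd => _ _ _ /free_info_injective inj.
  by rewrite ltr0n; exact: info_injective_dim_gt0 inj (tangent_card_gt0 nT).
rewrite /tau lt_min invr_gt0 ltr0n /=; apply: divr_gt0; first exact: mulr_gt0.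
rewrite sqrtr_gt0 /L_loc /kappa_loc; apply: mulr_gt0; last by lra.
apply: mulr_gt0; lra.
Qed.

Lemma tauE (R : realType) (n d : nat) (A : 'M[R]_(n, d)) (pstar : 'cV[R]_n)
    (eps : R) :
  tau A pstar eps =
  Num.min 4^-1
    (eps * d%:R / (4 * Num.sqrt (3 * L_star A pstar * kappa A pstar))).
Proof.
rewrite /tau /L_loc /kappa_loc; congr (Num.min _ (_ / _)).
have -> : 4 / 3 * (4 * L_star A pstar) * (9 * kappa A pstar)
    = 4 ^+ 2 * (3 * L_star A pstar * kappa A pstar) by field.
by rewrite sqrtrM ?sqr_ge0 // sqrtr_sqr ger0_norm.
Qed.

(* For i in S the Newton decrement bounds [v_i - d], the derivative in the
   tangent direction [e_i - p], whose local norm is at most [8 L_star]. *)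
Lemma small_decrement_vmax (R : realType) (n d : nat) (A : 'M[R]_(n, d))
    (pstar p : 'cV[R]_n) (eps l : R) :
  nondegenerate_design A pstar -> tangent R #|contact A pstar| <> [set 0] ->
  0 < eps -> sublevel A pstar p -> 0 <= l <= tau A pstar eps ->
  decrement_le A (contact A pstar) p l ->
  vmax (leverage A p) - d%:R <= eps * d%:R.
Proof.
move=> nd nT e0 ps /andP[l0 lt] dec.
have [mu0 muL k1] := spectral_bounds nd nT.
have [r0 r2 _ rg] := rbarE nd nT.
have lr := sublevel_lnorm nd nT ps.
have [[p0 p1] _] := sublevel_face nd nT ps.
have [qS q1 qd] := face_domain_design nd.
have [[pS _ pd] _] := ps.
set S := contact A pstar in nT dec rg qS pS *.
have m0 := tangent_card_gt0 nT.
have pE : pstar + (p - pstar) = p by rewrite subrKC.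
have ed0 : 0 <= eps * d%:R by rewrite mulr_ge0 // ltW.
rewrite lerBlDr; apply: bigmax_le => [|i _]; first by rewrite addr_ge0.
have [iS|iS] := boolP (i \in S); last first.
  (* Off S the leverage at [pstar] is at most d (1 - 2 r) with r = rbar, and moving to p costs a
     factor 1 / (1 - r), so it stays at most d. *)
  rewrite -pE; apply: le_trans (leverage_le i qd lr _) _; first by lra.
  rewrite mulrC ler_pdivrMr; last by lra.
  apply: le_trans (rg i iS) _.
  have d0 : 0 <= d%:R :> R by [].
  have : 0 <= d%:R * rbar A pstar by rewrite mulr_ge0 // ltW.
  have : 0 <= eps * d%:R * (1 - rbar A pstar) by rewrite mulr_ge0 //; lra.
  by nra.
set L := L_star A pstar in mu0 muL k1 *.
have L0 : 0 < L by exact: lt_le_trans muL.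
pose z : 'cV[R]_n := delta_mx i 0 - p.
have zS : supp z \subset S.
  apply: supp_sub => //; apply/supp_out => j jS; rewrite mxE.
  by rewrite (_ : j == i = false) //; apply: contraNF jS => /eqP ->.
have sd : \sum_j (delta_mx i 0 : 'cV[R]_n) j 0 = 1.
  rewrite (bigD1 i) //= big1 ?addr0 => [|j ji]; first by rewrite mxE !eqxx.
  by rewrite mxE (negbTE ji).
have z0 : \sum_j z j 0 = 0 by rewrite sum_sub p1 sd subrr.
have zE : extend (restrict_to S z) = z by exact: extend_restrict.
have Tz : tangent R #|S| (restrict_to S z).
  by rewrite /tangent /= -[RHS]z0 -[in RHS]zE sum_extend1.
have := dec _ Tz; rewrite zE.
have -> : dlogdet A p z = leverage A p i 0 - d%:R.
  rewrite -(dlogdet_self pd) /dlogdet.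
  rewrite -[X in X - _](_ : \sum_j (delta_mx i 0 : 'cV[R]_n) j 0 * leverage A p j 0 = _).
    by rewrite -sumrB; apply: eq_bigr => j _; rewrite [z j 0]mxE [X in _ + X]mxE mulrBl.
  rewrite (bigD1 i) //= big1 ?addr0 => [|j ji].
    by rewrite [X in X * _]mxE !eqxx mul1r.
  by rewrite [X in X * _]mxE (negbTE ji) mul0r.
rewrite lerBlDr => /le_trans; apply; rewrite lerD2r.
have pj1 j : p j 0 <= 1.
  by rewrite -p1 (bigD1 j) //= lerDl sumr_ge0.
(* Entrywise (delta - p)^2 <= delta + p, as both terms lie in [0, 1]; the right-hand side sums to
   2. *)
have zz : bform 1%:M (restrict_to S z) (restrict_to S z) <= 2.
  have -> : bform 1%:M (restrict_to S z) (restrict_to S z) = \sum_j z j 0 * z j 0.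
    rewrite bform1E -[in RHS]zE sum_extend; apply: eq_bigr => k _.
    by rewrite extend_enum_val.
  have -> : 2 = \sum_j ((delta_mx i 0 : 'cV[R]_n) j 0 + p j 0).
    by rewrite big_split /= sd p1.
  apply: ler_sum => j _; have := p0 j; have := pj1 j.
  rewrite /z !mxE; case: (j == i) => /=; nra.
(* A factor 2 comes from [zz], a factor 4 from (1 - rbar)^-2 with rbar <= 1/2. *)
have hz : hess A p z z <= 8 * L.
  rewrite -[in leLHS]pE; apply: le_trans (hess_le z qd lr _) _; first by lra.
  have hq : hess A pstar z z <= L * 2.
    rewrite -zE hess_extend.
    apply: le_trans (lambda_maxP m0 (Hhat_sym S qd) _) _.
    by rewrite ler_wpM2l // ltW.
  have c4 : (1 - rbar A pstar) ^- 2 <= 4.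
    rewrite invf_ple ?posrE ?exprn_gt0 //; last by lra.
    by nra.
  have h0 := hess_ge0 z qd.
  have c0 : 0 <= (1 - rbar A pstar) ^- 2 by rewrite invr_ge0 exprn_ge0; lra.
  by nra.
(* The radicand equals 48 L kappa, and kappa >= 1 leaves room for 8 L. *)
have ln : lnorm A p z <= Num.sqrt (4 / 3 * L_loc A pstar * kappa_loc A pstar).
  rewrite ler_wsqrtr // (le_trans hz) // /L_loc /kappa_loc -/L; nra.
apply: le_trans (ler_wpM2l l0 ln) _.
rewrite -ler_pdivlMr; first by apply: le_trans lt _; rewrite /tau ge_min lexx orbT.
rewrite sqrtr_gt0 /L_loc /kappa_loc -/L; apply: mulr_gt0; last by lra.
by apply: mulr_gt0; lra.
Qed.

(** * Runs of the algorithm *)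

Definition sound_iteration (R : realType) (n d : nat) (A : 'M[R]_(n, d))
    (pstar : 'cV[R]_n) (it : iteration R n) : Prop :=
  [/\ sublevel A pstar it.1.1, (size it.1.2 <= #|contact A pstar|.+1)%N &
      forall w, w \in it.1.2 -> simplex R n w /\ posdef (info A w)].

(** Damped and full steps have separate budgets; in [full_phase] the first is 0. *)
Definition bounded_run (R : realType) (n d : nat) (A : 'M[R]_(n, d))
    (pstar : 'cV[R]_n) (o : 'cV[R]_n -> 'cV[R]_n) (eps : R) (p : 'cV[R]_n)
    (kd kf : nat) : Prop :=
  exists (tr : seq (iteration R n)) (q : 'cV[R]_n),
    [/\ facial_newton_run o d (contact A pstar) eps p tr q,
        sublevel A pstar q /\ vmax (leverage A q) - d%:R <= eps * d%:R,
        (count (fun it => is_damped it.2) tr <= kd)%N /\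
        (count (fun it => is_full it.2) tr <= kf)%N,
        count (fun it => is_returned it.2) tr = 1%N /\
        (size tr <= kd + kf + 1)%N &
        List.Forall (sound_iteration A pstar) tr].

Lemma sound_queries (R : realType) (n d : nat) (A : 'M[R]_(n, d))
    (pstar p w : 'cV[R]_n) :
  nondegenerate_design A pstar -> tangent R #|contact A pstar| <> [set 0] ->
  sublevel A pstar p ->
  w \in p :: [seq midpoint p (enum_val j) | j <- enum 'I_#|contact A pstar|] ->
  simplex R n w /\ posdef (info A w).
Proof.
move=> nd nT ps; have [[p0 p1] _] := sublevel_face nd nT ps.
case: ps => [[_ _ pd] _]; rewrite inE => /orP[/eqP ->//|/mapP[j _ ->]].
have [pd' _] := leverage_rank_one_update (enum_val j) pd.
split; last by rewrite /midpoint infoZ; apply: posdefZ.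
split=> [i|].
  by rewrite !mxE mulr_ge0 ?invr_ge0 // addr_ge0.
transitivity (2^-1 * (\sum_i p i 0 + \sum_i (delta_mx (enum_val j) 0 : 'cV[R]_n) i 0)).
  by rewrite -big_split mulr_sumr; apply: eq_bigr => i _; rewrite !mxE.
rewrite p1 (bigD1 (enum_val j)) //= big1 ?addr0 => [|i ij].
  by rewrite mxE !eqxx /=; field.
by rewrite mxE (negbTE ij).
Qed.

(** The outcomes as the inductions need them. The full-step clause speaks of every known bound l' on
    the decrement; a bound of at most [tau] would have passed the test. The damped clause denies the
    bound 1/4, which excludes such a step once that bound is known. *)
Lemma facial_newton_step (R : realType) (n d : nat) (A : 'M[R]_(n, d))
    (pstar : 'cV[R]_n) (o : 'cV[R]_n -> 'cV[R]_n) (eps : R) (p : 'cV[R]_n) :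
  let S := contact A pstar in
  let E := exec o (facial_newton_iter d S eps p) in
  nondegenerate_design A pstar -> tangent R #|S| <> [set 0] ->
  leverage_oracle A o -> 0 < eps -> sublevel A pstar p ->
  exists qs : seq 'cV[R]_n,
    (forall r, sound_iteration A pstar (p, qs, r)) /\
    [\/ E = (qs, Returned p) /\ vmax (leverage A p) - d%:R <= eps * d%:R,
        exists p', [/\ E = (qs, DampedStep p'), sublevel A pstar p',
          fobj A p' < fobj A p - zeta 4^-1 & ~ decrement_le A S p 4^-1] |
        exists p' l, [/\ E = (qs, FullStep p'), sublevel A pstar p',
          0 <= l <= 4^-1, decrement_le A S p l & forall l', 0 <= l' ->
          decrement_le A S p l' ->
          tau A pstar eps < l' /\ decrement_le A S p' (l' ^+ 2)]].
Proof.
move=> S E nd nT ho e0 ps; have [[pS _ pd] _] := ps.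
have inj : info_injective_on A S.
  by case: nd => _ _ _; exact: free_info_injective.
have m0 := tangent_card_gt0 nT.
have snd := sound_queries nd nT ps.
have := exec_facial_newton eps ho inj pd pS m0; rewrite -/E.
have [vt hE|vt [x [Tx nx hE]]] := boolP (_ <= _).
  exists [:: p]; split; last by constructor 1.
  move=> r; split=> // w; rewrite inE => /eqP ->.
  by apply: snd; rewrite inE eqxx.
exists (p :: [seq midpoint p (enum_val j) | j <- enum 'I_#|S|]); split.
  by move=> r; split=> //=; rewrite size_map size_enum_ord.
have nxx := nx x Tx; set l := lnorm A p (extend x) in hE.
have l0 : 0 <= l by exact: sqrtr_ge0.
have l2 : hess A p (extend x) (extend x) = l ^+ 2 by rewrite sqr_lnorm.
have decl : decrement_le A S p l.
  by move=> y Ty; rewrite nx // mulrC; exact: hess_le_lnorm.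
(* Testing a bound at the Newton direction itself gives l^2 <= l' l. *)
have lmin l' : 0 <= l' -> decrement_le A S p l' -> l <= l'.
  move=> l'0 /(_ x Tx); rewrite nxx l2 -/l expr2.
  have [->//|ln] := eqVneq l 0.
  by rewrite ler_pM2r // lt_neqAle eq_sym ln.
have decW l' : l <= l' -> decrement_le A S p l'.
  by move=> ll' y /decl/le_trans; apply; rewrite ler_wpM2r ?sqrtr_ge0.
move: hE; rewrite /=; case: ifPn => l4 hE; [constructor 2|constructor 3].
  have [pd' fp'] := damped_step pd nxx; rewrite -/l in pd' fp'.
  have z4 : zeta 4^-1 < zeta l by exact: zeta_lt.
  have z0 : 0 <= zeta 4^-1 :> R by exact: zeta_ge0.
  exists (p + (1 + l)^-1 *: extend x); split=> //.
  - by apply: sublevel_step => //; lra.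
  - lra.
  - by move=> dec; have := lmin _ _ dec; rewrite invr_ge0 ler0n => /(_ isT); lra.
rewrite -leNgt in l4.
have [pd' fp'] := full_step pd nxx l4.
exists (p + extend x), l; split=> //.
- by have := @sublevel_step _ _ _ A pstar p x 1; rewrite scale1r; apply.
- by rewrite l0.
move=> l' l'0 dec'; split.
  rewrite ltNge; apply/negP => lt'; move/negP: vt; apply.
  by apply: (small_decrement_vmax nd nT e0 ps _ dec'); rewrite l'0.
move=> y Ty; apply: le_trans (newton_quadratic pd _ (nx y Ty)) _.
  by rewrite -/l; lra.
by rewrite ler_wpM2r ?sqrtr_ge0 // -/l ler_sqr ?nnegrE // lmin.
Qed.

(* Starting from l <= 1/4, k full steps bring the Newton decrement below
   [(2 l)^(2^k) / 2]. *)
Lemma full_phase (R : realType) (n d : nat) (A : 'M[R]_(n, d))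
    (pstar : 'cV[R]_n) (o : 'cV[R]_n -> 'cV[R]_n) (eps : R) (k : nat)
    (p : 'cV[R]_n) (l : R) :
  nondegenerate_design A pstar -> tangent R #|contact A pstar| <> [set 0] ->
  leverage_oracle A o -> 0 < eps -> sublevel A pstar p ->
  0 <= l <= 4^-1 -> decrement_le A (contact A pstar) p l ->
  (2 * l) ^+ (2 ^ k) <= 2 * tau A pstar eps ->
  bounded_run A pstar o eps p 0 k.
Proof.
move=> nd nT ho e0; elim: k p l => [|k IH] p l ps /andP[l0 l4] dec lt;
  have [qs [sq]] := facial_newton_step nd nT ho e0 ps.
- case=> [[hE vt]|[p' [_ _ _ []]]|[p' [l' [hE ps' _ _ /(_ l l0 dec)[]]]]].
  + exists [:: (p, qs, Returned p)], p; split=> //; first exact: run_return.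
    by constructor.
  + by move=> y /dec/le_trans; apply; rewrite ler_wpM2r ?sqrtr_ge0.
  (* With no full step left, [lt] reads l <= tau, where the test would have returned. *)
  + by move: lt; rewrite expn0 expr1; lra.
- case=> [[hE vt]|[p' [_ _ _ []]]|[p' [l' [hE ps' _ _ /(_ l l0 dec)[_ dec']]]]].
  + exists [:: (p, qs, Returned p)], p; split=> //; first exact: run_return.
    by constructor.
  + by move=> y /dec/le_trans; apply; rewrite ler_wpM2r ?sqrtr_ge0.
  + have [||tr [q [run okq [cd cf] [cr st] all]]] := IH p' (l ^+ 2) ps' _ dec'.
    * by rewrite sqr_ge0 /=; nra.
    (* The right-hand side is ((2 l)^2)^(2^k), and 2 l^2 <= (2 l)^2. *)
    * apply: le_trans lt; rewrite expnS exprM.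
      by apply: lerXn2r; rewrite ?nnegrE ?mulr_ge0 ?sqr_ge0 //; nra.
    exists ((p, qs, FullStep p') :: tr), q; split=> //.
    * exact: run_full run.
    * by constructor.
Qed.

(** The excess over the optimum is measured in units of zeta (1/4), and a damped step spends more
    than one. With less than one unit left (j = 0) it would lead below the minimum over the face. *)
Lemma damped_phase (R : realType) (n d : nat) (A : 'M[R]_(n, d))
    (pstar : 'cV[R]_n) (o : 'cV[R]_n -> 'cV[R]_n) (eps : R) (k j : nat)
    (p : 'cV[R]_n) :
  nondegenerate_design A pstar -> tangent R #|contact A pstar| <> [set 0] ->
  leverage_oracle A o -> 0 < eps -> sublevel A pstar p ->
  2^-1 ^+ (2 ^ k) <= 2 * tau A pstar eps ->
  fobj A p - fobj A pstar < j.+1%:R * zeta 4^-1 ->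
  bounded_run A pstar o eps p j k.
Proof.
move=> nd nT ho e0 + lt; elim: j p => [|j IH] p ps fp.
all: have [qs [sq]] := facial_newton_step nd nT ho e0 ps.
(* A full step certifies a decrement of at most 1/4 at p, so the rest of the run, this iteration
   included, is left to [full_phase]. *)
all: have full l : 0 <= l <= 4^-1 -> decrement_le A (contact A pstar) p l ->
    bounded_run A pstar o eps p 0 k
  by move=> l04 dec; apply: (full_phase nd nT ho e0 ps l04 dec);
     apply: le_trans lt; apply: lerXn2r; rewrite ?nnegrE; lra.
- case=> [[hE vt]|[p' [_ ps' fp' _]]|[p' [l [_ _ l04 dec _]]]].
  + exists [:: (p, qs, Returned p)], p; split=> //; first exact: run_return.
      by split=> //; rewrite addn1.
    by constructor.
  + by have := face_domain_min nd ps'.1; lra.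
  + exact: full dec.
- case=> [[hE vt]|[p' [hE ps' fp' _]]|[p' [l [_ _ l04 dec _]]]].
  + exists [:: (p, qs, Returned p)], p; split=> //; first exact: run_return.
    by constructor.
  + have [|tr [q [run okq [cd cf] [cr st] all]]] := IH p' ps'.
      by move: fp; rewrite -[j.+2]addn1 natrD mulrDl mul1r; lra.
    exists ((p, qs, DampedStep p') :: tr), q; split=> //.
    * exact: run_damped run.
    * by constructor.
  + have [tr [q [run okq [cd cf] [cr st] all]]] := full l l04 dec.
    exists tr, q; split=> //; first by split=> //; apply: leq_trans cd _.
    by split=> //; apply: leq_trans st _; rewrite leq_add2r leq_add2r.
Qed.

(** * Arithmetic of the iteration and query counts *)

(** Unwinding two logarithms: log2 (log2 z) <= k means z <= 2^(2^k), for z = 1 / (2 tau). As tau <=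
    1/4 gives z >= 2, both are taken at positive arguments. *)
Lemma full_step_bound_nat (R : realType) (n d : nat) (A : 'M[R]_(n, d))
    (pstar : 'cV[R]_n) (eps : R) :
  0 < tau A pstar eps -> exists k : nat,
    full_step_bound A pstar eps = k%:Z /\
    2^-1 ^+ (2 ^ k) <= 2 * tau A pstar eps.
Proof.
move=> t0; set t := tau A pstar eps in t0 *.
have t4 : t <= 4^-1 by rewrite /t /tau ge_min lexx.
have K0 : 0 <= full_step_bound A pstar eps by rewrite /full_step_bound le_max lexx orbT.
exists `|full_step_bound A pstar eps|%N; rewrite gez0_abs //; split=> //.
set k := `|_|%N.
have ln2 : 0 < ln 2 :> R by rewrite ln_gt0 // ltr1n.
set z := 1 / (2 * t); have z2 : 2 <= z by rewrite ler_pdivlMr; lra.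
have lz : 1 <= log2 z by rewrite ler_pdivlMr // mul1r ler_ln ?posrE //; lra.
have hk : log2 (log2 z) <= k%:R.
  apply: le_trans (ceil_ge _) _; rewrite -[k%:R]/(k%:Z%:~R) ler_int.
  by rewrite /k gez0_abs // /full_step_bound le_max lexx.
have h1 : log2 z <= 2 ^+ k.
  rewrite -ler_ln ?posrE ?exprn_gt0 //; last by lra.
  by rewrite lnXn // -[leRHS]mulr_natl -ler_pdivrMr.
rewrite -natrX in h1; set m := (2 ^ k)%N in h1 *; clearbody m.
have h2 : z <= 2 ^+ m.
  rewrite -ler_ln ?posrE ?exprn_gt0 //; last by lra.
  by rewrite lnXn // -[leRHS]mulr_natl -ler_pdivrMr.
rewrite exprVn -[leRHS]invrK lef_pV2 ?posrE ?exprn_gt0 ?invr_gt0 ?mulr_gt0 //.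
by rewrite -div1r.
Qed.

(** If tau = 1/4 the double logarithm is 0. Otherwise tau = 1 / X, and 1 / (2 tau) = X / 2 < X. The
    change of base costs the terms in ln 2, the ceiling costs 1. *)
Lemma full_step_bound_loglog (R : realType) (n d : nat) (A : 'M[R]_(n, d))
    (pstar : 'cV[R]_n) (eps : R) :
  0 < tau A pstar eps ->
  (full_step_bound A pstar eps)%:~R <=
  1 + (loglog (ThetaN A pstar / eps) + `|ln (ln 2)|) / ln 2 :> R.
Proof.
move=> t0; set X := ThetaN A pstar / eps; set LL := loglog X.
have LL1 : 1 <= LL by rewrite /LL /loglog le_max lexx.
have ln2 : 0 < ln 2 :> R by rewrite ln_gt0 // ltr1n.
have rhs0 : 0 <= (LL + `|ln (ln 2)|) / ln 2.
  by apply: divr_ge0; [have := normr_ge0 (ln (ln 2) : R)|]; lra.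
rewrite /full_step_bound; set y := log2 (log2 _).
suff hy : y <= (LL + `|ln (ln 2)|) / ln 2.
  rewrite /Num.max; case: ifP => _; first by rewrite /=; lra.
  by have := ceilB1_lt y; rewrite intrB; lra.
move: @y; set t := tau A pstar eps in t0 *; move=> y.
have [t4|t4] := eqVneq t 4^-1.
  suff -> : y = 0 by [].
  rewrite /y t4 /log2; have -> : 1 / (2 * 4^-1) = 2 :> R by field.
  by rewrite divff ?gt_eqF // ln1 mul0r.
have tX : t = X^-1.
  rewrite /X /ThetaN; move: t4; rewrite /t tauE minEle; case: ifP; rewrite ?eqxx //.
  by move=> _ _; rewrite !invf_div mulrA.
have tlt : t < 4^-1 by rewrite lt_neqAle t4 /t /tau ge_min lexx.
have X4 : 4 < X.
  by rewrite -[X]invrK -tX -[ltLHS]invrK ltf_pV2 ?posrE // invr_gt0.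
have zE : 1 / (2 * t) = X / 2 by rewrite tX; field; rewrite gt_eqF //; lra.
have lz : 0 < ln (1 / (2 * t)) by rewrite zE ln_gt0 //; lra.
have lX : ln (1 / (2 * t)) <= ln X by rewrite zE ler_ln ?posrE; lra.
rewrite /y /log2 ler_pM2r ?invr_gt0 // ln_div ?posrE //.
have h1 : ln (ln (1 / (2 * t))) <= ln (ln X) by rewrite ler_ln ?posrE //; lra.
have h2 : ln (ln X) <= LL by rewrite /LL /loglog le_max lexx orbT.
have h3 := ler_norm (- ln (ln 2) : R); rewrite normrN in h3.
lra.
Qed.

Lemma total_queries_le (R : realType) (n d : nat) (A : 'M[R]_(n, d))
    (pstar : 'cV[R]_n) (tr : seq (iteration R n)) :
  List.Forall (sound_iteration A pstar) tr ->
  (total_queries tr <= size tr * #|contact A pstar|.+1)%N.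
Proof.
rewrite /total_queries; elim=> [|it tr' [_ sz _] _ IH]; first by rewrite big_nil.
by rewrite big_cons /= mulSn leq_add.
Qed.

Theorem theorem6p6 (R : realType) :
  exists C : R,
  forall (n d : nat) (A : 'M[R]_(n, d)) (pstar : 'cV[R]_n)
         (o : 'cV[R]_n -> 'cV[R]_n) (eps : R) (p0 : 'cV[R]_n),
  let S := contact A pstar in
  let K := full_step_bound A pstar eps in
  let LL := loglog (ThetaN A pstar / eps) in
  \rank A = d ->
  nondegenerate_design A pstar ->
  tangent R #|S| <> [set 0] ->
  leverage_oracle A o ->
  0 < eps < 1 ->
  relint (face R S) p0 ->
  fobj A p0 - fobj A pstar <= c0 A pstar ->
  tau A pstar eps =
    Num.min 4^-1 (eps * d%:R / (4 * Num.sqrt (3 * L_star A pstar * kappa A pstar)))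
  /\
  exists (tr : seq (iteration R n)) (p : 'cV[R]_n),
    facial_newton_run o d S eps p0 tr p /\
    [/\ (* (i) *)
        [/\ relint (face R S) p,
            vmax (leverage A p) <= (1 + eps) * d%:R,
            [/\ (count (fun it => is_damped it.2) tr <= 3)%N,
                (count (fun it => is_full it.2) tr)%:Z <= K &
                count (fun it => is_returned it.2) tr = 1%N],
            (size tr)%:Z <= 3 + K + 1 &
            (3 + K + 1)%:~R <= C + C * LL],
        (* (ii) *)
        [/\ all (fun it => size it.1.2 <= #|S|.+1)%N tr,
            (#|S|.+1 <= 'C(d.+1, 2).+1)%N,
            forall w, w \in flatten [seq it.1.2 | it <- tr] ->
              simplex R n w /\ posdef (info A w) &
            (total_queries tr)%:R <= C * d%:R ^+ 2 * LL] &
        (* (iii) *)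
        (forall q, q \in [seq it.1.1 | it <- tr] -> sublevel A pstar q) /\
        sublevel A pstar `<=` relint (face R S)].
Proof.
have ln2 : 0 < ln 2 :> R by rewrite ln_gt0 // ltr1n.
(* Three damped steps, the terminal test and the rounding of the ceiling make 5; the other summand
   collects the constants of [full_step_bound_loglog]. *)
pose C1 : R := 5 + (1 + `|ln (ln 2)|) / ln 2.
have q0 : 0 <= `|ln (ln 2)| / ln 2 :> R by rewrite divr_ge0 // ltW.
have q1 : 0 < (ln 2)^-1 :> R by rewrite invr_gt0.
have C15 : 5 <= C1 by rewrite /C1 mulrDl mul1r; lra.
(* The factor 4 is needed for the queries: 2 from C1 + C1 LL <= 2 C1 LL, and 2 from m + 1 <= 2
   d^2. *)
exists (4 * C1) => n d A pstar o eps p0 S K LL _ nd nT ho /andP[e0 _] rp0 fp0.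
split; first exact: tauE.
have inj : info_injective_on A S by case: nd => _ _ _; exact: free_info_injective.
have m0 := tangent_card_gt0 nT.
have ps0 := relint_sublevel nd rp0 fp0.
have t0 := tau_gt0 nd nT e0.
have [k [KE kt]] := full_step_bound_nat t0.
have [r0 r2 _ _] := rbarE nd nT.
have fp4 : fobj A p0 - fobj A pstar < 4%:R * zeta 4^-1.
  apply: le_lt_trans fp0 _; apply: le_lt_trans (zeta_half_quarter R).
  rewrite /c0; move: r2; rewrite le_eqVlt => /orP[/eqP ->//|r2].
  by rewrite ltW // zeta_lt // ltW.
have [tr [q [run [psq vq] [cd cf] [cr st] snd]]] :=
  damped_phase nd nT ho e0 ps0 kt fp4.
have LL1 : 1 <= LL by rewrite /LL /loglog le_max lexx.
have bK : (3 + K + 1)%:~R <= C1 + C1 * LL.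
  rewrite !intrD; have := full_step_bound_loglog t0; rewrite -/LL -/K.
  have : 0 <= `|ln (ln 2)| / ln 2 * LL by rewrite mulr_ge0 //; lra.
  rewrite /C1 !mulrDl !mul1r; nra.
have subr := sublevel_relint nd nT.
exists tr, q; split=> //.
have cS := info_injective_card inj.
split.
- split=> //.
  + exact: subr.
  + by lra.
  + by split=> //; rewrite /K KE lez_nat.
  + rewrite /K KE -!PoszD lez_nat; exact: st.
  + apply: le_trans bK _; nra.
- split.
  + by elim: snd => //= it tr' [_ -> _] _ ->.
  + by [].
  + move=> w; elim: snd => //= it tr' [_ _ hw] _ IH.
    by rewrite mem_cat => /orP[/hw|/IH].
  + have := total_queries_le snd; rewrite -/S => tq.
    have d1 : 1 <= d%:R :> R.
      by rewrite ler1n; exact: info_injective_dim_gt0 inj m0.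
    have s1 : (size tr)%:R <= C1 + C1 * LL.
      apply: le_trans bK; rewrite /K KE -[(size tr)%:R]/((size tr)%:Z%:~R) ler_int.
      by rewrite -!PoszD lez_nat.
    (* d (d + 1) / 2 + 1 <= 2 d^2, with equality at d = 1. *)
    have s2 : #|S|.+1%:R <= 2 * d%:R ^+ 2 :> R.
      apply: (@le_trans _ _ ('C(d.+1, 2).+1)%:R); first by rewrite ler_nat.
      have : ('C(d.+1, 2) * 2)%:R = (d.+1 * d)%:R :> R.
        by rewrite mulnC -mul_bin_diag bin1.
      rewrite !natrM -[d.+1]addn1 -[_.+1]addn1 !natrD; nra.
    apply: (@le_trans _ _ ((size tr)%:R * #|S|.+1%:R)); first by rewrite -natrM ler_nat.
    apply: le_trans (ler_pM _ _ s1 s2) _; rewrite ?ler0n //.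
    have : 0 <= C1 * d%:R ^+ 2 * (LL - 1).
      by rewrite !mulr_ge0 ?sqr_ge0 ?subr_ge0 //; lra.
    by lra.
- split=> //; elim: snd => //= it tr' [hs _ _] _ IH w.
  by rewrite inE => /orP[/eqP ->|/IH].
Qed.
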